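(* Let $\mathfrak g$ be a finite-dimensional complex Lie algebra and $H=U(\mathfrak g)$. Every semisimple unital associative $H$-pseudoalgebra $R$ is differential, i.e. there is an $X^{cop}$-algebra $A$ such that $R\cong \mathrm{Diff}\,A$ as $H$-pseudoalgebras.
   Context: Ground field $\mathbb C$; $H=U(\mathfrak g)$ has its standard Hopf structure $(\Delta,\varepsilon,S)$, Sweedler notation $\Delta(h)=h_{(1)}\otimes h_{(2)}$. Pseudoalgebras. An associative $H$-pseudoalgebra is a left $H$-module $R$ with a linear map $R\otimes R\to (H\otimes H)\otimes_H R$, $a\otimes b\mapsto a*b$ (where $H$ acts on $H\otimes H$ from the right via $\Delta$), such that $(fa)*(gb)=((f\otimes g)\otimes_H 1)(a*b)$ for $f,g\in H$, and $(a*b)*c=a*(b*c)$ in $H^{\otimes 3}\otimes_H R$. Here, if $d*c=\sum_i\beta_i\otimes_H c_i$, then $(\gamma\otimes_H d)*c=\sum_i(\gamma\otimes 1)(\Delta\otimes\mathrm{id})(\beta_i)\otimes_H c_i$, and if $a*d=\sum_i\beta_i\otimes_H c_i$, then $a*(\gamma\otimes_H d)=\sum_i(1\otimes\gamma)(\mathrm{id}\otimes\Delta)(\beta_i)\otimes_H c_i$, for $\gamma\in H\otimes H$. Dual algebra and $x$-products. $X=H^*=\mathrm{Hom}_{\mathbb C}(H,\mathbb C)$ is a commutative algebra with $\langle xy,h\rangle=\langle x,h_{(1)}\rangle\langle y,h_{(2)}\rangle$ and unit $1=\varepsilon$; it has a coproduct $\Delta:X\to X\hat\otimes X=(H\otimes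 H)^*$, $\langle x,fg\rangle=\langle x_{(1)},f\rangle\langle x_{(2)},g\rangle$, and antipode $\langle S(x),h\rangle=\langle x,S(h)\rangle$. Every $a*b$ can be written as $\sum_i(f_i\otimes 1)\otimes_H e_i$, and for $x\in X$ one puts $a_xb=\sum_i\langle S(x),f_i\rangle e_i\in R$. Thus $a*b=\sum_i(S(h_i)\otimes1)\otimes_H(a_{x_i}b)$ for dual bases $\{h_i\},\{x_i\}$ of $H$, $X$. Semisimple. An ideal of $R$ is an $H$-submodule $I$ with $I_xR\subset I$, $R_xI\subset I$ for all $x\in X$. A pseudoalgebra $N$ is nilpotent if for some $n$ all products $N_{x_1}N_{x_2}\cdots_{x_n}N$, $x_i\in X$, vanish. $R$ is semisimple if it has no nonzero nilpotent ideals. Unital. $\mathrm{Cur}\,\mathbb C=He$ is the free rank one $H$-module with $e*e=(1\otimes1)\otimes_H e$. Any (pseudo)module $V$ over it decomposes as $V=V^0\oplus V^1$ with $e*V^0=0$ and $e_1v=v$ for $v\in V^1$. $R$ is unital if there is an embedding of pseudoalgebras $\mathrm{Cur}\,\mathbb C\to R$ such that, for $R$ viewed as a left $\mathrm{Cur}\,\mathbb C$-module, $R^0=0$ (i.e. $e_1r=r$ for all $r\in R$). Differential pseudoalgebras. An $X^{cop}$-algebra is an associative algebra $A$ that is a left $X$-module with $x(ab)=(x_{(2)}a)(x_{(1)}b)$ and such that the annihilator in $X$ of each $a\in A$ has finite codimension. $\mathrm{Diff}\,A$ is the free $H$-module $H\otimes A$ with pseudoproduct determined by $H$-bilinearity and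 $(1\otimes a)_x(1\otimes b)=1\otimes(a\,x(b))$, $x\in X$, i.e. $(1\otimes a)*(1\otimes b)=\sum_i(S(h_i)\otimes1)\otimes_H(1\otimes a\,x_i(b))$. *)

(* Defs.v *)
From HB Require Import structures.
From mathcomp Require Import all_boot all_order all_algebra.
From mathcomp Require Import boolp classical_sets functions cardinality fsbigop.

Set Implicit Arguments.
Unset Strict Implicit.
Unset Printing Implicit Defensive.

Import GRing.Theory.
Local Open Scope ring_scope.
Local Open Scope quotient_scope.

Section Tensor.
Variables (A : pzRingType) (M : zmodType) (N : lmodType A) (act : M -> A -> M).

Record balanced (P : zmodType) (f : M -> N -> P) : Prop := Balanced {
  balancedDl : forall m m' n, f (m + m') n = f m n + f m' n;
  balancedDr : forall m n n', f m (n + n') = f m n + f m n';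
  balancedM : forall m a n, f (act m a) n = f m (a *: n)
}.

Definition tens_eval (P : zmodType) (f : M -> N -> P) (s : seq (M * N)) : P :=
  \sum_(p <- s) f p.1 p.2.

(* Two formal sums are identified when no balanced map tells them apart: this is
   the congruence generated by biadditivity and (m . a) (x) n = m (x) (a n). *)
Definition tens_rel (s t : seq (M * N)) : bool :=
  `[< forall (P : zmodType) (f : M -> N -> P),
        balanced f -> tens_eval f s = tens_eval f t >].

Lemma tens_rel_equiv : equiv_class_of tens_rel.
Proof.
split=> [s|s t|t s u]; first by apply/asboolP.
  by apply/asboolP/asboolP => h P f bf; rewrite h.
move=> /asboolP h1 /asboolP h2; apply/asboolP => P f bf.
by rewrite h1 // h2.
Qed.
Canonical tens_equiv := EquivRelPack tens_rel_equiv.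

(* M (x)_A N, for the right action act of A on M. *)
Definition tens : Type := {eq_quot tens_rel}.
HB.instance Definition _ := Choice.on tens.
HB.instance Definition _ := EqQuotient.on tens.

Definition tens_class (s : seq (M * N)) : tens := \pi_tens s.
Definition tpure (m : M) (n : N) : tens := tens_class [:: (m, n)].

(* The map M (x)_A N -> P induced by a balanced map f. *)
Definition tlift (P : zmodType) (f : M -> N -> P) (t : tens) : P :=
  tens_eval f (repr t).

Lemma tens_classP (s t : seq (M * N)) :
  (forall (P : zmodType) (f : M -> N -> P),
      balanced f -> tens_eval f s = tens_eval f t) ->
  tens_class s = tens_class t.
Proof. by move=> h; apply/eqmodP/asboolP. Qed.

Lemma tlift_class (P : zmodType) (f : M -> N -> P) (s : seq (M * N)) :
  balanced f -> tlift f (tens_class s) = tens_eval f s.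
Proof.
move=> bf; rewrite /tlift.
have /eqmodP/asboolP : repr (tens_class s) = s %[mod tens] by rewrite reprK.
by move=> ->.
Qed.

Lemma tens_repr (t : tens) : tens_class (repr t) = t.
Proof. by rewrite /tens_class reprK. Qed.

Lemma tensP (s t : tens) :
  (forall (P : zmodType) (f : M -> N -> P),
      balanced f -> tlift f s = tlift f t) -> s = t.
Proof.
by move=> h; rewrite -(tens_repr s) -(tens_repr t); apply: tens_classP.
Qed.

Definition tens_opp_seq (s : seq (M * N)) := [seq (- p.1, p.2) | p <- s].
Definition tens_add (s t : tens) : tens := tens_class (repr s ++ repr t).
Definition tens_opp (s : tens) : tens := tens_class (tens_opp_seq (repr s)).

Lemma tens_eval_cat (P : zmodType) (f : M -> N -> P) s t :
  tens_eval f (s ++ t) = tens_eval f s + tens_eval f t.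
Proof. exact: big_cat. Qed.

Lemma balancedNl (P : zmodType) (f : M -> N -> P) m n :
  balanced f -> f (- m) n = - f m n.
Proof.
move=> bf; apply: (addrI (f m n)); rewrite -balancedDl // !subrr.
by apply: (addrI (f 0 n)); rewrite -balancedDl // !addr0.
Qed.

Lemma tens_eval_opp (P : zmodType) (f : M -> N -> P) s :
  balanced f -> tens_eval f (tens_opp_seq s) = - tens_eval f s.
Proof.
move=> bf; rewrite /tens_eval big_map -sumrN.
by apply: eq_bigr => p _ /=; rewrite balancedNl.
Qed.

Lemma tlift_add (P : zmodType) (f : M -> N -> P) s t :
  balanced f -> tlift f (tens_add s t) = tlift f s + tlift f t.
Proof. by move=> bf; rewrite tlift_class // tens_eval_cat. Qed.

Fact tens_addA : associative tens_add.
Proof. by move=> s t u; apply: tensP => P f bf; rewrite !tlift_add // addrA. Qed.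
Fact tens_addC : commutative tens_add.
Proof. by move=> s t; apply: tensP => P f bf; rewrite !tlift_add // addrC. Qed.
Fact tens_add0 : left_id (tens_class [::]) tens_add.
Proof.
move=> s; apply: tensP => P f bf.
by rewrite tlift_add // tlift_class // /tens_eval big_nil add0r.
Qed.
Fact tens_addN : left_inverse (tens_class [::]) tens_opp tens_add.
Proof.
move=> s; apply: tensP => P f bf.
rewrite tlift_add // !tlift_class // tens_eval_opp // addNr.
by rewrite /tens_eval big_nil.
Qed.

HB.instance Definition _ :=
  GRing.isZmodule.Build tens tens_addA tens_addC tens_add0 tens_addN.

Lemma tliftD (P : zmodType) (f : M -> N -> P) : balanced f ->
  {morph tlift f : s t / s + t}.
Proof. by move=> bf s t; apply: tlift_add. Qed.

Lemma tlift0 (P : zmodType) (f : M -> N -> P) : balanced f -> tlift f 0 = 0.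
Proof. by move=> bf; apply: (addrI (tlift f 0)); rewrite -tliftD // !addr0. Qed.

Lemma tliftE (P : zmodType) (f : M -> N -> P) m n : balanced f ->
  tlift f (tpure m n) = f m n.
Proof. by move=> bf; rewrite tlift_class // /tens_eval big_seq1. Qed.

Lemma tpure_balanced : balanced tpure.
Proof.
split=> *; apply: tensP => P f bf; rewrite ?tliftD // !tliftE //.
- by rewrite balancedDl.
- by rewrite balancedDr.
- by rewrite balancedM.
Qed.

Lemma tens_ind (Q : tens -> Prop) :
  Q 0 -> (forall s t, Q s -> Q t -> Q (s + t)) ->
  (forall m n, Q (tpure m n)) -> forall t, Q t.
Proof.
move=> Q0 QD Qp t; rewrite -(tens_repr t).
elim: (repr t) => [|[m n] s IH]; first exact: Q0.
suff -> : tens_class ((m, n) :: s) = tpure m n + tens_class s by apply: QD.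
apply: tensP => P f bf; rewrite tliftD // tliftE // !tlift_class //.
by rewrite /tens_eval big_cons.
Qed.

Lemma eq_tlift (P : zmodType) (f f' : M -> N -> P) t :
  (forall m n, f m n = f' m n) -> tlift f t = tlift f' t.
Proof. by move=> h; apply: eq_bigr => p _. Qed.

End Tensor.

Section KTensor.
Variable K : fieldType.

Definition kact (M : lmodType K) (m : M) (c : K) : M := c *: m.

Definition ktens (M N : lmodType K) : Type :=
  tens (A := K) N (@kact M).
HB.instance Definition _ (M N : lmodType K) := GRing.Zmodule.on (ktens M N).

Definition kpure (M N : lmodType K) (m : M) (n : N) : ktens M N := tpure _ m n.
Definition klift (M N : lmodType K) (P : zmodType) (f : M -> N -> P)
  (t : ktens M N) : P := tlift f t.

Section Lmodule.
Variables M N : lmodType K.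
Implicit Types t : ktens M N.

Definition ktens_scale (c : K) t : ktens M N :=
  tlift (fun m n => kpure (c *: m) n) t.

Fact ktens_scale_balanced (c : K) :
  balanced (@kact M) (fun m n => kpure (c *: m) n : ktens M N).
Proof.
have [Dl Dr Z] := tpure_balanced (A := K) N (@kact M).
by split=> *; rewrite ?scalerDr /kpure ?Dl ?Dr // scalerA mulrC -scalerA Z.
Qed.

Lemma ktens_scale_pure c m n : ktens_scale c (kpure m n) = kpure (c *: m) n.
Proof. by apply: tliftE; apply: ktens_scale_balanced. Qed.

Lemma ktens_scaleDr : right_distributive ktens_scale +%R.
Proof. by move=> c s t; apply: tliftD; apply: ktens_scale_balanced. Qed.

Lemma ktens_scale0 c : ktens_scale c 0 = 0.
Proof. by apply: tlift0; apply: ktens_scale_balanced. Qed.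

Fact ktens_scaleA a b t : ktens_scale a (ktens_scale b t) = ktens_scale (a * b) t.
Proof.
elim/tens_ind: t => [|s t IHs IHt|m n]; rewrite ?ktens_scale0 //.
  by rewrite !ktens_scaleDr IHs IHt.
by rewrite !ktens_scale_pure scalerA.
Qed.
Fact ktens_scale1 : left_id 1 ktens_scale.
Proof.
elim/tens_ind => [|s t IHs IHt|m n]; rewrite ?ktens_scale0 //.
  by rewrite !ktens_scaleDr IHs IHt.
by rewrite !ktens_scale_pure scale1r.
Qed.
Fact ktens_scaleDl t : {morph ktens_scale^~ t : a b / a + b}.
Proof.
move=> a b; elim/tens_ind: t => [|s t IHs IHt|m n].
- by rewrite !ktens_scale0 addr0.
- by rewrite !ktens_scaleDr IHs IHt addrACA.
by rewrite !ktens_scale_pure scalerDl /kpure (balancedDl (tpure_balanced _ _)).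
Qed.
HB.instance Definition _ := GRing.Zmodule_isLmodule.Build K (ktens M N)
  ktens_scaleA ktens_scale1 ktens_scaleDr ktens_scaleDl.

Lemma kpureDl m m' n : kpure (m + m') n = kpure m n + kpure m' n :> ktens M N.
Proof. exact: balancedDl (tpure_balanced _ _) _ _ _. Qed.
Lemma kpureDr m n n' : kpure m (n + n') = kpure m n + kpure m n' :> ktens M N.
Proof. exact: balancedDr (tpure_balanced _ _) _ _ _. Qed.
Lemma kpureZl c m n : kpure (c *: m) n = c *: kpure m n :> ktens M N.
Proof. by rewrite -ktens_scale_pure. Qed.
Lemma kpureZr c m n : kpure m (c *: n) = c *: kpure m n :> ktens M N.
Proof.
rewrite -kpureZl; exact: esym (balancedM (tpure_balanced _ _) _ _ _).
Qed.

Lemma kbalanced (P : lmodType K) (f : M -> N -> P) :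
  (forall n, linear (f^~ n)) -> (forall m, linear (f m)) ->
  balanced (@kact M) f.
Proof.
move=> fl fr.
have Z0l n : f 0 n = 0.
  have := fl n (-1) 0 0; rewrite scaleN1r oppr0 addr0 scaleN1r => ->.
  by rewrite addNr.
have Z0r m : f m 0 = 0.
  have := fr m (-1) 0 0; rewrite scaleN1r oppr0 addr0 scaleN1r => ->.
  by rewrite addNr.
split=> [m m' n|m n n'|m a n].
- by have := fl n 1 m m'; rewrite !scale1r.
- by have := fr m 1 n n'; rewrite !scale1r.
have := fl n a m 0; have := fr m a n 0.
by rewrite !addr0 Z0l Z0r !addr0 => -> ->.
Qed.

Lemma klift_is_linear (P : lmodType K) (f : M -> N -> P) :
  (forall n, linear (f^~ n)) -> (forall m, linear (f m)) -> linear (klift f).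
Proof.
move=> fl fr; have bf := kbalanced fl fr; move=> c s t.
rewrite /klift (tliftD bf); congr (_ + _).
elim/tens_ind: s => [|s s' IH IH'|m n].
- by rewrite (scaler0 (ktens M N)) (tlift0 bf) scaler0.
- by rewrite (scalerDr c (s : ktens M N)) !(tliftD bf) IH IH' scalerDr.
rewrite -[tpure _ m n]/(kpure m n) -kpureZl !(tliftE _ _ bf).
have fl0 : f 0 n = 0.
  by have := fl n (-1) 0 0; rewrite scaleN1r oppr0 addr0 scaleN1r addNr.
by have := fl n c m 0; rewrite !addr0 fl0 addr0.
Qed.

Lemma klift_pure (P : lmodType K) (f : M -> N -> P) m n :
  (forall n, linear (f^~ n)) -> (forall m, linear (f m)) ->
  klift f (kpure m n) = f m n.
Proof. by move=> fl fr; apply/tliftE/kbalanced. Qed.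

End Lmodule.

Lemma ktens_ind (M N : lmodType K) (Q : ktens M N -> Prop) :
  (forall s t, Q s -> Q t -> Q (s + t)) ->
  (forall m n, Q (kpure m n)) -> forall t, Q t.
Proof.
move=> QD Qp; apply: tens_ind => //.
by have := Qp 0 0; rewrite -(scale0r (0 : M)) kpureZl scale0r.
Qed.

(* A linear form normalised at 1; it only serves to show that 1 (x) 1 != 0. *)
Lemma exists_normalised_form (M : lalgType K) :
  exists2 phi : M -> K, linear_for *%R phi & phi 1 = 1.
Proof.
pose Pr (W : set M) :=
  (forall a u v, W u -> W v -> W (a *: u + v)) /\ ~ W 1.
have [|W [[Wl W1] Wmax]] := @Zorn_bigcup M Pr.
  move=> F FP Ftot; split=> [a u v [X FX Xu] [Y FY Yv]|[X FX X1]].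
    have [XY|YX] := Ftot X Y FX FY.
      by exists Y => //; apply: (FP _ FY).1 => //; apply: XY.
    by exists X => //; apply: (FP _ FX).1 => //; apply: YX.
  exact: (FP _ FX).2.
have W0 : W 0.
  apply: contrapT => nW0; refine (Wmax [set w | W w \/ w = 0]%classic _ _).
    by split=> [w Ww|h]; [left|apply: nW0; apply: h; right].
  split=> [a u v [Wu|->] [Wv|->]|[//|/eqP]]; last by rewrite oner_eq0.
  - by left; apply: Wl.
  - rewrite addr0; have [->|a0] := eqVneq a 0; first by rewrite scale0r; right.
    left; have -> : a *: u = (a - 1) *: u + u by rewrite scalerBl scale1r subrK.
    exact: Wl.
  - by rewrite scaler0 add0r; left.
  - by rewrite scaler0 addr0; right.
have Wex m : exists c : K, W (m - c%:A).
  apply: contrapT => /forallNP nW.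
  refine (Wmax [set w | exists a, exists2 u, W u & w = u + a *: m]%classic _ _).
    split=> [w Ww|h]; first by exists 0, w => //; rewrite scale0r addr0.
    apply: (nW 0); rewrite scale0r subr0; apply: h.
    by exists 1, 0 => //; rewrite scale1r add0r.
  split=> [a _ _ [b [u Wu ->]] [c [v Wv ->]]|[a [u Wu h]]].
    exists (a * b + c), (a *: u + v); first exact: Wl.
    by rewrite scalerDr scalerDl scalerA addrACA.
  have [a0|a0] := eqVneq a 0.
    by apply: W1; rewrite h a0 scale0r addr0.
  apply: (nW a^-1); rewrite h scalerDr scalerA mulVf // scale1r.
  by rewrite opprD addrCA subrr addr0 -scaleNr -[_ *: u]addr0; apply: Wl.
have [phi phiP] := choice Wex.
have Wuniq m c : W (m - c%:A) -> phi m = c.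
  move=> Wc; apply: contrapT => /eqP; rewrite -subr_eq0 => d0; apply: W1.
  have : W ((phi m - c)%:A).
    have := Wl (-1) _ _ (phiP m) Wc.
    by rewrite scaleN1r opprB addrA subrK -scalerBl.
  move=> /(Wl (phi m - c)^-1 _ 0)/(_ W0).
  by rewrite addr0 scalerA mulVf // scale1r.
exists phi => [a u v|]; last by apply: Wuniq; rewrite scale1r subrr.
apply: Wuniq; have := Wl a _ _ (phiP u) (phiP v).
by rewrite scalerBr scalerDl scalerA opprD addrACA.
Qed.

Section Algebra.
Variables M N : algType K.

Definition kmul (s t : ktens M N) : ktens M N :=
  klift (fun a b => klift (fun a' b' => kpure (a * a') (b * b')) t) s.

Fact kmul_balanced2 a b : balanced (@kact M)
  (fun a' b' => kpure (a * a') (b * b') : ktens M N).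
Proof.
apply: kbalanced => [n c m m'|m c n n'].
  by rewrite mulrDr -scalerAr kpureDl kpureZl.
by rewrite mulrDr -scalerAr kpureDr kpureZr.
Qed.

Fact kmul_balanced1 t : balanced (@kact M)
  (fun a b => klift (fun a' b' => kpure (a * a') (b * b') : ktens M N) t).
Proof.
apply: kbalanced => [b c a1 a2|a c b1 b2]; elim/ktens_ind: t => [s t|a' b'].
- rewrite /klift !(tliftD (kmul_balanced2 _ _)) => -> ->.
  by rewrite scalerDr addrACA.
- rewrite /klift !(tliftE _ _ (kmul_balanced2 _ _)).
  by rewrite mulrDl -scalerAl kpureDl kpureZl.
- rewrite /klift !(tliftD (kmul_balanced2 _ _)) => -> ->.
  by rewrite scalerDr addrACA.
- rewrite /klift !(tliftE _ _ (kmul_balanced2 _ _)).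
  by rewrite mulrDl -scalerAl kpureDr kpureZr.
Qed.

Lemma kmul_pure a b a' b' :
  kmul (kpure a b) (kpure a' b') = kpure (a * a') (b * b').
Proof.
rewrite /kmul /klift (tliftE _ _ (kmul_balanced1 _)).
by rewrite /klift (tliftE _ _ (kmul_balanced2 _ _)).
Qed.

Fact kmulDl : left_distributive kmul +%R.
Proof. by move=> s t u; rewrite /kmul /klift (tliftD (kmul_balanced1 _)). Qed.

Fact kmulDr : right_distributive kmul +%R.
Proof.
move=> u s t; elim/ktens_ind: u => [u v IHu IHv|a b].
  by rewrite !kmulDl IHu IHv addrACA.
rewrite /kmul /klift !(tliftE _ _ (kmul_balanced1 _)).
by rewrite /klift (tliftD (kmul_balanced2 _ _)).
Qed.

Fact kmulA : associative kmul.
Proof.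
move=> s t u; elim/ktens_ind: s => [s s' IH IH'|a b].
  by rewrite !kmulDl IH IH'.
elim/ktens_ind: t => [t t' IH IH'|a' b'].
  by rewrite !(kmulDl, kmulDr) IH IH'.
elim/ktens_ind: u => [u u' IH IH'|a'' b''].
  by rewrite !kmulDr IH IH'.
by rewrite !kmul_pure !mulrA.
Qed.

Fact kmul1l : left_id (kpure 1 1) kmul.
Proof.
elim/ktens_ind => [s t IHs IHt|a b]; first by rewrite kmulDr IHs IHt.
by rewrite kmul_pure !mul1r.
Qed.

Fact kmul1r : right_id (kpure 1 1) kmul.
Proof.
elim/ktens_ind => [s t IHs IHt|a b]; first by rewrite kmulDl IHs IHt.
by rewrite kmul_pure !mulr1.
Qed.

Fact kone_neq0 : kpure 1 1 != 0 :> ktens M N.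
Proof.
have [phi phiL phi1] := exists_normalised_form M.
have [psi psiL psi1] := exists_normalised_form N.
have bf : balanced (@kact M)
    (fun m n => phi m * psi n : K^o).
  apply: kbalanced => [n c m m'|m c n n'].
    by rewrite phiL mulrDl -mulrA.
  by rewrite psiL mulrDr mulrCA.
apply/eqP => /(congr1 (klift (fun m n => phi m * psi n : K^o))).
rewrite /klift (tliftE _ _ bf) (tlift0 bf) phi1 psi1 mulr1 => /eqP.
by rewrite oner_eq0.
Qed.

HB.instance Definition _ := GRing.Zmodule_isNzRing.Build (ktens M N)
  kmulA kmul1l kmul1r kmulDl kmulDr kone_neq0.

Fact kscaleAl (c : K) (s t : ktens M N) : c *: (s * t) = (c *: s) * t.
Proof.
elim/ktens_ind: s => [s s' IH IH'|a b].
  by rewrite scalerDr !mulrDl scalerDr IH IH'.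
elim/ktens_ind: t => [t t' IH IH'|a' b'].
  by rewrite !mulrDr scalerDr IH IH'.
rewrite -kpureZl /GRing.mul /= !kmul_pure -kpureZl.
by rewrite scalerAl.
Qed.
HB.instance Definition _ := GRing.Lmodule_isLalgebra.Build K (ktens M N) kscaleAl.

Fact kscaleAr (c : K) (s t : ktens M N) : c *: (s * t) = s * (c *: t).
Proof.
elim/ktens_ind: s => [s s' IH IH'|a b].
  by rewrite !mulrDl scalerDr IH IH'.
elim/ktens_ind: t => [t t' IH IH'|a' b'].
  by rewrite scalerDr !mulrDr scalerDr IH IH'.
rewrite -kpureZl /GRing.mul /= !kmul_pure -kpureZl.
by rewrite scalerAr.
Qed.
HB.instance Definition _ := GRing.Lalgebra_isAlgebra.Build K (ktens M N) kscaleAr.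

Lemma kpureM (a a' : M) (b b' : N) :
  kpure a b * kpure a' b' = kpure (a * a') (b * b') :> ktens M N.
Proof. exact: kmul_pure. Qed.

End Algebra.
End KTensor.

Section ConverseAlgebra.
Variables (K : fieldType) (B : algType K).
HB.instance Definition _ := GRing.Lmodule.copy B^c B.
Fact converse_scaleAl (c : K) (x y : B^c) : c *: (x * y) = (c *: x : B^c) * y.
Proof. exact: (scalerAr c (y : B) (x : B)). Qed.
HB.instance Definition _ :=
  GRing.Lmodule_isLalgebra.Build K B^c converse_scaleAl.
Fact converse_scaleAr (c : K) (x y : B^c) : c *: (x * y) = x * (c *: y : B^c).
Proof. exact: (scalerAl c (y : B) (x : B)). Qed.
HB.instance Definition _ :=
  GRing.Lalgebra_isAlgebra.Build K B^c converse_scaleAr.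
End ConverseAlgebra.

Record is_lie_bracket (K : fieldType) (g : lmodType K) (br : g -> g -> g) : Prop :=
  IsLieBracket {
    lie_linearl : forall y, linear (br^~ y);
    lie_linearr : forall x, linear (br x);
    lie_alternating : forall x, br x x = 0;
    lie_jacobi : forall x y z,
      br x (br y z) + br y (br z x) + br z (br x y) = 0
  }.

Section Enveloping.
Variables (K : fieldType) (g : lmodType K) (br : g -> g -> g).

Record lie_to_alg (B : algType K) (f : g -> B) : Prop := LieToAlg {
  lta_linear : linear f;
  lta_br : forall x y, f (br x y) = f x * f y - f y * f x
}.

(* (c, [:: x1; ...; xn]) stands for the tensor c x1 (x) ... (x) xn. *)
Definition env_eval (B : algType K) (f : g -> B) (s : seq (K * seq g)) : B :=
  \sum_(p <- s) p.1 *: \prod_(x <- p.2) f x.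

(* Tensors are identified when no Lie map from g to an associative algebra tells
   them apart: this is the congruence modulo the two-sided ideal of T(g) generated
   by the x (x) y - y (x) x - [x, y]. *)
Definition env_rel (s t : seq (K * seq g)) : bool :=
  `[< forall (B : algType K) (f : g -> B),
        lie_to_alg f -> env_eval f s = env_eval f t >].

Lemma env_rel_equiv : equiv_class_of env_rel.
Proof.
split=> [s|s t|t s u]; first by apply/asboolP.
  by apply/asboolP/asboolP => h B f bf; rewrite h.
move=> /asboolP h1 /asboolP h2; apply/asboolP => B f bf.
by rewrite h1 // h2.
Qed.
Canonical env_equiv := EquivRelPack env_rel_equiv.

(* U(g). *)
Definition env : Type := {eq_quot env_rel}.
HB.instance Definition _ := Choice.on env.
HB.instance Definition _ := EqQuotient.on env.

Definition env_class (s : seq (K * seq g)) : env := \pi_env s.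
Definition iota (x : g) : env := env_class [:: (1, [:: x])].

(* The algebra morphism U(g) -> B that extends a Lie map f. *)
Definition env_ext (B : algType K) (f : g -> B) (u : env) : B :=
  env_eval f (repr u).

Lemma env_ext_class (B : algType K) (f : g -> B) s :
  lie_to_alg f -> env_ext f (env_class s) = env_eval f s.
Proof.
move=> bf; rewrite /env_ext.
have /eqmodP/asboolP : repr (env_class s) = s %[mod env] by rewrite reprK.
by move=> ->.
Qed.

Lemma env_repr u : env_class (repr u) = u.
Proof. by rewrite /env_class reprK. Qed.

Lemma envP (u v : env) :
  (forall (B : algType K) (f : g -> B),
      lie_to_alg f -> env_ext f u = env_ext f v) -> u = v.
Proof.
move=> h; rewrite -(env_repr u) -(env_repr v).
by apply/eqmodP/asboolP.
Qed.

Definition env_scale_seq (c : K) (s : seq (K * seq g)) :=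
  [seq (c * p.1, p.2) | p <- s].
Definition env_mul_seq (s t : seq (K * seq g)) :=
  [seq (p.1 * q.1, p.2 ++ q.2) | p <- s, q <- t].

Definition env_add (u v : env) := env_class (repr u ++ repr v).
Definition env_scale (c : K) (u : env) := env_class (env_scale_seq c (repr u)).
Definition env_mul (u v : env) := env_class (env_mul_seq (repr u) (repr v)).
Definition env_one : env := env_class [:: (1, [::])].

Section Ext.
Variables (B : algType K) (f : g -> B).
Hypothesis bf : lie_to_alg f.

Lemma env_ext_add u v : env_ext f (env_add u v) = env_ext f u + env_ext f v.
Proof. by rewrite env_ext_class // /env_eval big_cat. Qed.

Lemma env_ext_nil : env_ext f (env_class [::]) = 0.
Proof. by rewrite env_ext_class // /env_eval big_nil. Qed.

Lemma env_ext_scale c u : env_ext f (env_scale c u) = c *: env_ext f u.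
Proof.
rewrite env_ext_class // /env_eval big_map scaler_sumr.
by apply: eq_bigr => p _; rewrite scalerA.
Qed.

Lemma env_ext_mul u v : env_ext f (env_mul u v) = env_ext f u * env_ext f v.
Proof.
rewrite env_ext_class // /env_eval big_allpairs_dep mulr_suml.
apply: eq_bigr => p _; rewrite mulr_sumr; apply: eq_bigr => q _ /=.
by rewrite big_cat -scalerAl -scalerAr scalerA.
Qed.

Lemma env_ext_one : env_ext f env_one = 1.
Proof. by rewrite env_ext_class // /env_eval big_seq1 big_nil scale1r. Qed.

Lemma env_ext_iota x : env_ext f (iota x) = f x.
Proof. by rewrite env_ext_class // /env_eval !big_seq1 scale1r. Qed.
End Ext.

Definition env_extE := (env_ext_add, env_ext_nil, env_ext_scale, env_ext_mul,
  env_ext_one).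

Fact env_addA : associative env_add.
Proof. by move=> u v w; apply: envP => B f bf; rewrite !env_extE // addrA. Qed.
Fact env_addC : commutative env_add.
Proof. by move=> u v; apply: envP => B f bf; rewrite !env_extE // addrC. Qed.
Fact env_add0 : left_id (env_class [::]) env_add.
Proof. by move=> u; apply: envP => B f bf; rewrite !env_extE // add0r. Qed.
Fact env_addN : left_inverse (env_class [::]) (env_scale (-1)) env_add.
Proof.
by move=> u; apply: envP => B f bf; rewrite !env_extE // scaleN1r addNr.
Qed.
HB.instance Definition _ :=
  GRing.isZmodule.Build env env_addA env_addC env_add0 env_addN.

Fact env_mulA : associative env_mul.
Proof. by move=> u v w; apply: envP => B f bf; rewrite !env_extE // mulrA. Qed.
Fact env_mul1l : left_id env_one env_mul.
Proof. by move=> u; apply: envP => B f bf; rewrite !env_extE // mul1r. Qed.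
Fact env_mul1r : right_id env_one env_mul.
Proof. by move=> u; apply: envP => B f bf; rewrite !env_extE // mulr1. Qed.
Fact env_mulDl : left_distributive env_mul +%R.
Proof. by move=> u v w; apply: envP => B f bf; rewrite !env_extE // mulrDl. Qed.
Fact env_mulDr : right_distributive env_mul +%R.
Proof. by move=> u v w; apply: envP => B f bf; rewrite !env_extE // mulrDr. Qed.

Lemma counit_lie : lie_to_alg (fun _ : g => 0 : K^o).
Proof. by split=> [c x y|x y]; rewrite ?scaler0 ?mul0r ?subrr ?addr0. Qed.

Fact env_one_neq0 : env_one != 0.
Proof.
apply/eqP => /(congr1 (env_ext (fun _ : g => 0 : K^o))).
have bf := counit_lie.
by rewrite env_ext_one // env_ext_nil // => /eqP; rewrite oner_eq0.
Qed.
HB.instance Definition _ := GRing.Zmodule_isNzRing.Build env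
  env_mulA env_mul1l env_mul1r env_mulDl env_mulDr env_one_neq0.

Fact env_scaleA a b u : env_scale a (env_scale b u) = env_scale (a * b) u.
Proof. by apply: envP => B f bf; rewrite !env_extE // scalerA. Qed.
Fact env_scale1 : left_id 1 env_scale.
Proof. by move=> u; apply: envP => B f bf; rewrite !env_extE // scale1r. Qed.
Fact env_scaleDr : right_distributive env_scale +%R.
Proof. by move=> c u v; apply: envP => B f bf; rewrite !env_extE // scalerDr. Qed.
Fact env_scaleDl u : {morph env_scale^~ u : a b / a + b}.
Proof. by move=> a b; apply: envP => B f bf; rewrite !env_extE // scalerDl. Qed.
HB.instance Definition _ := GRing.Zmodule_isLmodule.Build K env
  env_scaleA env_scale1 env_scaleDr env_scaleDl.

Fact env_scaleAl (c : K) (u v : env) : c *: (u * v) = (c *: u) * v.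
Proof.
apply: envP => B f bf; rewrite /GRing.mul /GRing.scale /= !env_extE //.
by rewrite scalerAl.
Qed.
HB.instance Definition _ := GRing.Lmodule_isLalgebra.Build K env env_scaleAl.
Fact env_scaleAr (c : K) (u v : env) : c *: (u * v) = u * (c *: v).
Proof.
apply: envP => B f bf; rewrite /GRing.mul /GRing.scale /= !env_extE //.
by rewrite scalerAr.
Qed.
HB.instance Definition _ := GRing.Lalgebra_isAlgebra.Build K env env_scaleAr.

Section ExtMorphism.
Variables (B : algType K) (f : g -> B).
Hypothesis bf : lie_to_alg f.
Lemma env_ext_is_linear : linear (env_ext f).
Proof. by move=> c u v; rewrite env_ext_add // env_ext_scale. Qed.
Lemma env_extM : {morph env_ext f : u v / u * v}.
Proof. exact: env_ext_mul. Qed.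
Lemma env_ext1 : env_ext f 1 = 1.
Proof. exact: env_ext_one. Qed.
End ExtMorphism.

Lemma iota_lie : lie_to_alg iota.
Proof.
split=> [c x y|x y]; apply: envP => B f bf.
  rewrite env_ext_is_linear // !env_ext_iota //; exact: lta_linear.
have -> : iota x * iota y - iota y * iota x
          = (-1) *: (iota y * iota x) + iota x * iota y.
  by rewrite scaleN1r addrC.
rewrite env_ext_is_linear // !env_extM // !env_ext_iota // scaleN1r addrC.
exact: lta_br.
Qed.

(* The Hopf structure, given on generators by
   x |-> x (x) 1 + 1 (x) x, x |-> 0 and x |-> - x. *)
Definition Delta : env -> ktens env env :=
  env_ext (fun x => kpure (iota x) 1 + kpure 1 (iota x) : ktens env env).
Definition counit : env -> K^o := env_ext (fun _ => 0 : K^o).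
(* The antipode reverses products, hence the opposite algebra. *)
Definition antipode : env -> env := env_ext (fun x => - iota x : env^c).

Lemma Delta_lie :
  lie_to_alg (fun x => kpure (iota x) 1 + kpure 1 (iota x) : ktens env env).
Proof.
split=> [c x y|x y].
  rewrite (lta_linear iota_lie) kpureDl kpureDr kpureZl kpureZr.
  by rewrite scalerDr addrACA.
rewrite (lta_br iota_lie) !mulrDl !mulrDr !kpureM !mul1r !mulr1.
rewrite kpureDl kpureDr -!scaleN1r kpureZl kpureZr !scaleN1r.
rewrite [kpure _ 1 + kpure (iota y) _ + _ in RHS]addrACA opprD [RHS]addrACA.
by congr (_ + _); rewrite opprD addrACA subrr ?addr0 ?add0r.
Qed.

Lemma antipode_lie : lie_to_alg (fun x => - iota x : env^c).
Proof.
split=> [c x y|x y].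
  by rewrite (lta_linear iota_lie) opprD scalerN.
rewrite (lta_br iota_lie) opprB.
have E (u v : env) : ((- u : env^c) * (- v : env^c) : env^c) = (v * u : env).
  exact: mulrNN.
by rewrite !E.
Qed.

End Enveloping.

Section Pseudoalgebras.
Variables (K : fieldType) (g : lmodType K) (br : g -> g -> g).
Notation H := (env br).
Notation H2 := (ktens H H).
Notation H3 := (ktens H2 H).

Lemma counit_is_linear : linear (@counit K g br).
Proof. exact/env_ext_is_linear/counit_lie. Qed.
Lemma Delta_is_linear : linear (@Delta K g br).
Proof. exact/env_ext_is_linear/Delta_lie. Qed.

Definition Delta_id : H2 -> H3 :=
  klift (fun h k => kpure (Delta h) k : H3).
Definition id_Delta : H2 -> H3 :=
  klift (fun h k => klift (fun k' k'' => kpure (kpure h k' : H2) k'' : H3) (Delta k)).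

(* gamma (x) 1 and 1 (x) gamma. *)
Definition tens_one (c : H2) : H3 := kpure c 1.
Definition one_tens (c : H2) : H3 :=
  klift (fun h k => kpure (kpure 1 h : H2) k : H3) c.

(* H (x) H and H (x) H (x) H as right H-modules. *)
Definition act2 (c : H2) (h : H) : H2 := c * Delta h.
Definition act3 (c : H3) (h : H) : H3 := c * Delta_id (Delta h).

(* (H (x) H) (x)_H V and (H (x) H (x) H) (x)_H V. *)
Definition tens2 (V : lmodType H) : zmodType := tens V act2.
Definition tens3 (V : lmodType H) : zmodType := tens V act3.
Definition pure2 (V : lmodType H) (c : H2) (v : V) : tens2 V := tpure act2 c v.
Definition pure3 (V : lmodType H) (c : H3) (v : V) : tens3 V := tpure act3 c v.

Definition lmul2 (V : lmodType H) (c : H2) (t : tens2 V) : tens2 V :=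
  tlift (fun b v => pure2 (c * b) v) t.

Definition map2 (V W : lmodType H) (phi : V -> W) (t : tens2 V) : tens2 W :=
  tlift (fun b v => pure2 b (phi v)) t.

Definition pseudoproduct (V : lmodType H) := V -> V -> tens2 V.

Section PseudoproductTheory.
Variables (V : lmodType H) (pp : pseudoproduct V).

(* (c (x)_H d) * w and w * (c (x)_H d). *)
Definition pp_l (t : tens2 V) (w : V) : tens3 V :=
  tlift (fun c d =>
    tlift (fun b v => pure3 (tens_one c * Delta_id b) v) (pp d w)) t.
Definition pp_r (w : V) (t : tens2 V) : tens3 V :=
  tlift (fun c d =>
    tlift (fun b v => pure3 (one_tens c * id_Delta b) v) (pp w d)) t.

(* K-bilinearity follows from biadditivity and H-bilinearity. *)
Record is_bilinear_pp : Prop := IsBilinearPp {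
  ppDl : forall a b c, pp (a + b) c = pp a c + pp b c;
  ppDr : forall a b c, pp a (b + c) = pp a b + pp a c;
  ppH : forall (f h : H) a b,
    pp (f *: a) (h *: b) = lmul2 (kpure f h) (pp a b)
}.

Record is_assoc_pseudoalgebra : Prop := IsAssocPseudoalgebra {
  pp_bilinear : is_bilinear_pp;
  ppA : forall a b c, pp_l (pp a b) c = pp_r a (pp b c)
}.

End PseudoproductTheory.

Record is_pp_morphism (V W : lmodType H) (pp : pseudoproduct V)
    (qq : pseudoproduct W) (phi : V -> W) : Prop := IsPpMorphism {
  ppm_linear : linear phi;
  ppm_pp : forall a b, qq (phi a) (phi b) = map2 phi (pp a b)
}.

Definition pp_isomorphic (V W : lmodType H) (pp : pseudoproduct V)
    (qq : pseudoproduct W) : Prop :=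
  exists2 phi : V -> W, is_pp_morphism pp qq phi & bijective phi.

(* X = H^*. *)
Definition dual : Type := {scalar H}.
Identity Coercion scalar_of_dual : dual >-> GRing.Linear.type.

Lemma dual_ext (x y : dual) : x =1 y -> x = y.
Proof.
case: x y => [f [[Df] [Zf]]] [f' [[Df'] [Zf']]] /= /funext E.
case: _ / E in Df' Zf' *.
by rewrite (Prop_irrelevance Df Df') (Prop_irrelevance Zf Zf').
Qed.


HB.instance Definition _ := gen_eqMixin dual.
HB.instance Definition _ := gen_choiceMixin dual.

Definition dual_of (f : H -> K) (fl : linear_for *%R f) : dual :=
  HB.pack_for {scalar H} f (GRing.isLinear.Build K H K *%R f fl).

Fact dual0_subproof : linear_for *%R (fun _ : H => 0 : K).
Proof. by move=> c u v; rewrite mulr0 addr0. Qed.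
Fact dualD_subproof (x y : dual) : linear_for *%R (fun h => x h + y h).
Proof. by move=> c u v; rewrite !linearP mulrDr addrACA. Qed.
Fact dualN_subproof (x : dual) : linear_for *%R (fun h => - x h).
Proof. by move=> c u v; rewrite linearP opprD mulrN. Qed.
Fact dualZ_subproof (c : K) (x : dual) : linear_for *%R (fun h => c * x h).
Proof. by move=> d u v; rewrite linearP mulrDr mulrCA. Qed.

Definition dual0 := dual_of dual0_subproof.
Definition dualD x y := dual_of (dualD_subproof x y).
Definition dualN x := dual_of (dualN_subproof x).
Definition dualZ c x := dual_of (dualZ_subproof c x).

Fact dualDA : associative dualD.
Proof. by move=> x y z; apply: dual_ext => h /=; rewrite addrA. Qed.
Fact dualDC : commutative dualD.
Proof. by move=> x y; apply: dual_ext => h /=; rewrite addrC. Qed.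
Fact dualD0 : left_id dual0 dualD.
Proof. by move=> x; apply: dual_ext => h /=; rewrite add0r. Qed.
Fact dualDN : left_inverse dual0 dualN dualD.
Proof. by move=> x; apply: dual_ext => h /=; rewrite addNr. Qed.
HB.instance Definition _ :=
  GRing.isZmodule.Build dual dualDA dualDC dualD0 dualDN.

Fact dualZA a b x : dualZ a (dualZ b x) = dualZ (a * b) x.
Proof. by apply: dual_ext => h /=; rewrite mulrA. Qed.
Fact dualZ1 : left_id 1 dualZ.
Proof. by move=> x; apply: dual_ext => h /=; rewrite mul1r. Qed.
Fact dualZDr : right_distributive dualZ +%R.
Proof. by move=> c x y; apply: dual_ext => h /=; rewrite mulrDr. Qed.
Fact dualZDl x : {morph dualZ^~ x : a b / a + b}.
Proof. by move=> a b; apply: dual_ext => h /=; rewrite mulrDl. Qed.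
HB.instance Definition _ := GRing.Zmodule_isLmodule.Build K dual
  dualZA dualZ1 dualZDr dualZDl.

(* The unit of X is the counit of H; the product of X is dual to Delta. *)
Definition dual1 : dual := dual_of counit_is_linear.

Fact dualM_subproof (x y : dual) : linear_for *%R
  (fun h => klift (fun h1 h2 => x h1 * y h2 : K^o) (Delta h)).
Proof.
move=> c u v; rewrite Delta_is_linear klift_is_linear //.
  by move=> k d h h'; rewrite linearP mulrDl -mulrA.
by move=> h d k k'; rewrite linearP mulrDr mulrCA.
Qed.
Definition dualM (x y : dual) : dual := dual_of (dualM_subproof x y).

Record is_dual_basis (I : choiceType) (h : I -> H) (x : I -> dual) : Prop :=
  IsDualBasis {
    dual_basis_span : forall u, exists (s : seq I) (c : I -> K),
      u = \sum_(i <- s) c i *: h i;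
    dual_basisE : forall i j, x i (h j) = (i == j)%:R
  }.

Section XProducts.
Variables (V : lmodType H) (pp : pseudoproduct V).

(* If a * b = \sum_i (f_i (x) 1) (x)_H e_i then a_x b = \sum_i <S(x), f_i> e_i,
   where <S(x), f> = <x, S(f)>. Such an expression of a * b always exists, and
   the result does not depend on it. *)
Definition xprod (x : dual) (a b : V) : V :=
  let s := xget [::] [set s : seq (H * V) |
    pp a b = \sum_(p <- s) pure2 (kpure p.1 1) p.2]%classic in
  \sum_(p <- s) (x (antipode p.1))%:A *: p.2.

Record is_ideal (I : set V) : Prop := IsIdeal {
  ideal0 : I 0;
  idealD : forall a b, I a -> I b -> I (a + b);
  idealZ : forall (h : H) a, I a -> I (h *: a);
  ideal_xl : forall x a b, I a -> I (xprod x a b);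
  ideal_xr : forall x a b, I b -> I (xprod x a b)
}.

(* The products (.. (a_0 _{x_1} a_1) _{x_2} ..) _{x_n} a_n with all a_i in N. *)
Fixpoint xpower (N : set V) (n : nat) : set V :=
  if n is m.+1 then
    [set c | exists a x b, [/\ xpower N m a, N b & c = xprod x a b]]%classic
  else N.

Definition is_nilpotent (N : set V) : Prop :=
  exists n, forall c, xpower N n c -> c = 0.

Definition is_semisimple : Prop :=
  forall I, is_ideal I -> is_nilpotent I -> forall a, I a -> a = 0.

End XProducts.

(* Cur K = H e with e = 1. *)
Definition cur_pp : pseudoproduct H^o := fun f h => pure2 (kpure f h) (1 : H^o).

Definition is_unital (V : lmodType H) (pp : pseudoproduct V) : Prop :=
  exists phi : H^o -> V, [/\ is_pp_morphism cur_pp pp phi, injective phi &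
    forall r, xprod pp dual1 (phi 1) r = r].

Section Diff.
Variable A : lmodType K.

(* A need not have a unit. In xcop_mul, the element x_(1) (x) x_(2) of the
   completed tensor square is the series of the <x, h_i h_j> x_i (x) x_j; only
   finitely many terms act nontrivially, A being locally finite. *)
Record is_Xcop_algebra (mul : A -> A -> A) (act : dual -> A -> A) : Prop :=
  IsXcopAlgebra {
    xcop_mull : forall b, linear (mul^~ b);
    xcop_mulr : forall a, linear (mul a);
    xcop_mulA : associative mul;
    xcop_actl : forall a, linear (act^~ a);
    xcop_actr : forall x, linear (act x);
    xcop_act1 : forall a, act dual1 a = a;
    xcop_actM : forall x y a, act (dualM x y) a = act x (act y a);
    xcop_mul : forall (I : choiceType) (h : I -> H) (xi : I -> dual),
      is_dual_basis h xi -> forall x a b, act x (mul a b) =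
        \sum_(p \in [set: I * I]%classic)
          x (h p.1 * h p.2) *: mul (act (xi p.2) a) (act (xi p.1) b);
    xcop_fin : forall a, exists (n : nat) (y : 'I_n -> dual),
      forall x, exists c : 'I_n -> K, act (x - \sum_(i < n) c i *: y i) a = 0
  }.

(* H (x) A as an H-module; ktens H A only carries its K-module structure. *)
Definition diff : Type := ktens H A.
HB.instance Definition _ := GRing.Zmodule.on diff.
Definition diff_pure (h : H) (a : A) : diff := kpure h a.

Definition diff_scale (h : H) (t : diff) : diff :=
  klift (fun k a => kpure (h * k) a) t.

Lemma diff_lin_l (h : H) (a : A) : linear (fun k : H => kpure (h * k) a).
Proof. by move=> c k k'; rewrite mulrDr -scalerAr kpureDl kpureZl. Qed.
Lemma diff_lin_r (h k : H) : linear (fun a : A => kpure (h * k) a).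
Proof. by move=> c a a'; rewrite kpureDr kpureZr. Qed.

Lemma diff_scale_pure h k a : diff_scale h (diff_pure k a) = diff_pure (h * k) a.
Proof.
by rewrite /diff_scale klift_pure //; [exact: diff_lin_l|exact: diff_lin_r].
Qed.
Fact diff_scaleDr : right_distributive diff_scale +%R.
Proof.
move=> h s t; apply: tliftD; apply: kbalanced.
  exact: diff_lin_l.
exact: diff_lin_r.
Qed.
Fact diff_scaleA h k t : diff_scale h (diff_scale k t) = diff_scale (h * k) t.
Proof.
elim/ktens_ind: t => [s t IHs IHt|l a]; first by rewrite !diff_scaleDr IHs IHt.
by rewrite !diff_scale_pure mulrA.
Qed.
Fact diff_scale1 : left_id 1 diff_scale.
Proof.
elim/ktens_ind => [s t IHs IHt|l a]; first by rewrite diff_scaleDr IHs IHt.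
by rewrite diff_scale_pure mul1r.
Qed.
Fact diff_scaleDl t : {morph diff_scale^~ t : h k / h + k}.
Proof.
move=> h k; elim/ktens_ind: t => [s t IHs IHt|l a].
  by rewrite !diff_scaleDr IHs IHt addrACA.
by rewrite !diff_scale_pure mulrDl /diff_pure kpureDl.
Qed.
HB.instance Definition _ := GRing.Zmodule_isLmodule.Build H diff
  diff_scaleA diff_scale1 diff_scaleDr diff_scaleDl.

(* These conditions determine the pseudoproduct of Diff A. *)
Record is_diff_pp (mul : A -> A -> A) (act : dual -> A -> A)
    (pp : pseudoproduct diff) : Prop := IsDiffPp {
  diff_bilinear : is_bilinear_pp pp;
  diff_ppE : forall x a b,
    xprod pp x (diff_pure 1 a) (diff_pure 1 b) = diff_pure 1 (mul a (act x b))
}.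

End Diff.

Definition is_differential (V : lmodType H) (pp : pseudoproduct V) : Prop :=
  exists (A : lmodType K) (mul : A -> A -> A) (act : dual -> A -> A),
    is_Xcop_algebra mul act /\
    exists2 dpp : pseudoproduct (diff A),
      is_diff_pp mul act dpp & pp_isomorphic pp dpp.

End Pseudoalgebras.

(* Main.v *)
From HB Require Import structures.
Require Import Defs.
From mathcomp Require Import all_boot all_order all_algebra.
From mathcomp Require Import boolp classical_sets fsbigop.
From mathcomp Require Import reals complex.

(* Let e be the unit. As e * e = (1 (x) 1) (x)_H e, the map r |-> r * e makes R a
   Hopf module over H. If r * e = 0 then r * s = 0 for all s, because s = e_1 s is
   a coefficient of e * s; such r form an ideal with zero product, so r is
   determined by r * e. Write r * e = \sum (f_i (x) 1) (x)_H a_i with independent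
   f_i. The a_i are then of the form r_x e and lie in
   A = {a | a * e = (1 (x) 1) (x)_H a}, and r = \sum f_i a_i since both sides have
   the same product with e. Hence R = H (x) A, and A is an X^cop-algebra for
   a b = a_1 b and x(b) = e_x b, which satisfy a_x b = a_1 (e_x b).
   Every identity between x-products is obtained by pairing one tensor leg of an
   instance of associativity in H^(x)3 (x)_H R with some x. *)

Set Implicit Arguments.
Unset Strict Implicit.
Unset Printing Implicit Defensive.

Import GRing.Theory.
Local Open Scope ring_scope.

(** Elements of (H (x) H) (x)_H R carry no coordinates and are compared through maps out of the
    tensor product. The map f (x) 1 |-> <S(x), f> extends to a right H-linear map H (x) H -> H, and
    tensored with R it takes a * b to a_x b. On H^(x)3 it can act on legs 1, 2 or on legs 2, 3.
    Applied to (a * b) * c = a * (b * c), the first choice turns the left side into (a_x b) * c and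
    the second turns the right side into a * (b_x c). The opposite side is then computed from what
    is known about the products in it, such as a * e = (1 (x) 1) (x)_H a. The independent f_i are
    realised by a finite-rank operator u |-> \sum x_i(u) h_i that fixes the finitely many elements
    of H at hand. It yields r = \sum h_i a_i with a_i = r_(S(x_i)) e, and again the injectivity of h
    (x) a |-> h a. *)

(** * Separating linear forms *)

Lemma exists_separating_form (K : fieldType) (M : lmodType K) (m : M) :
  m != 0 -> exists2 phi : M -> K, linear_for *%R phi & phi m = 1.
Proof.
(* A maximal W is a hyperplane that misses [m], and [phi] will be the coefficient of [m] modulo W.
   [Pr] does not ask for 0, because the union of the empty chain has to satisfy it. *)
move=> m0; pose Pr (W : set M) :=
  (forall a u v, W u -> W v -> W (a *: u + v)) /\ ~ W m.
have [F FP Ftot|W [[Wl Wm] Wmax]] := @Zorn_bigcup M Pr.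
  split=> [a u v [Y FY Yu] [Z FZ Zv]|[Y FY]]; last exact: (FP _ FY).2.
  have [YZ|ZY] := Ftot Y Z FY FZ.
    by exists Z => //; apply: (FP _ FZ).1 => //; apply: YZ.
  by exists Y => //; apply: (FP _ FY).1 => //; apply: ZY.
have WZ a u : W u -> W (a *: u).
  by move=> Wu; rewrite -[a](subrK 1) scalerDl scale1r; apply: Wl.
(* A maximal W contains 0; W \/ {0} spares a separate proof. *)
pose W0 u := W u \/ u = 0.
have W0l a u v : W0 u -> W0 v -> W0 (a *: u + v).
  case=> [Wu|->] [Wv|->]; rewrite ?scaler0 ?add0r ?addr0; last by right.
  - by left; apply: Wl.
  - by left; apply: WZ.
  - by left.
have W0m : ~ W0 m by case=> // /eqP; rewrite (negbTE m0).
have ext v : ~ W v -> exists2 a, a != 0 & W0 (m - a *: v).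
  move=> Wv; apply: contrapT => nex.
  refine (Wmax [set w | exists a, W0 (w - a *: v)]%classic _ _).
    split=> [w Ww|sub]; first by exists 0; rewrite scale0r subr0; left.
    by apply: Wv; apply: sub; exists 1; rewrite scale1r subrr; right.
  split=> [a u w [b ub] [c wc]|[a ma]].
    exists (a * b + c); have := W0l a _ _ ub wc.
    by rewrite scalerBr scalerA addrACA -opprD -scalerDl.
  apply: nex; exists a => //; apply/eqP => a0; apply: W0m.
  by rewrite a0 scale0r subr0 in ma.
have WP v : exists c, W0 (v - c *: m).
  have [Wv|/ext[a a0 Wa]] := pselect (W v).
    by exists 0; rewrite scale0r subr0; left.
  exists a^-1; have := W0l (- a^-1) _ 0 Wa (or_intror erefl).
  by rewrite addr0 scaleNr scalerBr scalerA mulVf // scale1r opprB.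
have [phi phiP] := choice WP.
have phi_uniq v c : W0 (v - c *: m) -> phi v = c.
  move=> Wc; apply/eqP; rewrite -subr_eq0; apply: contrapT => /negP d0.
  apply: W0m; have := W0l (-1) _ _ (phiP v) Wc.
  rewrite scaleN1r opprB addrA subrK -scalerBl => Wd.
  have := W0l (phi v - c)^-1 _ 0 Wd (or_intror erefl).
  by rewrite addr0 scalerA mulVf // scale1r.
exists phi => [a u v|]; last by apply: phi_uniq; rewrite scale1r subrr; right.
apply: phi_uniq; have := W0l a _ _ (phiP u) (phiP v).
by rewrite scalerBr scalerDl scalerA opprD addrACA.
Qed.

(** * Finite sums and linear maps on tensor products over K *)

Section TensorNormal.
Variables (K : fieldType) (M N : lmodType K).

Lemma ktens_normal (t : ktens M N) :
  exists s : seq (M * N), t = \sum_(p <- s) kpure p.1 p.2.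
Proof.
elim/ktens_ind: t => [_ _ [s ->] [s' ->]|m n].
  by exists (s ++ s'); rewrite big_cat.
by exists [:: (m, n)]; rewrite big_seq1.
Qed.

Lemma kpure_sumr (I : Type) (r : seq I) (m : M) (F : I -> N) :
  kpure m (\sum_(i <- r) F i) = \sum_(i <- r) kpure m (F i).
Proof.
have kpure0 : kpure m (0 : N) = 0 by rewrite -(scale0r (0 : N)) kpureZr scale0r.
exact: (big_morph _ (kpureDr m) kpure0).
Qed.

Lemma kpure_suml (I : Type) (r : seq I) (F : I -> M) (n : N) :
  kpure (\sum_(i <- r) F i) n = \sum_(i <- r) kpure (F i) n.
Proof.
have kpure0 : kpure (0 : M) n = 0 by rewrite -(scale0r (0 : M)) kpureZl scale0r.
exact: (big_morph (fun m => kpure m n) (fun m m' => kpureDl m m' n) kpure0).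
Qed.
End TensorNormal.

Section TensorLinear.
Variables (K : fieldType) (M N P : lmodType K) (f : M -> N -> P).
Hypotheses (fl : forall n, linear (f^~ n)) (fr : forall m, linear (f m)).

Lemma klift0 : klift f 0 = 0.
Proof. exact/tlift0/kbalanced. Qed.

Lemma kliftD s t :
  klift f (s + t) = klift f s + klift f t.
Proof. exact/tliftD/kbalanced. Qed.

Lemma kliftZ c : {morph klift f : s / c *: s}.
Proof.
move=> s; have := klift_is_linear fl fr c s 0.
by rewrite addr0 klift0 addr0.
Qed.

End TensorLinear.

(** * The Hopf structure of U(g) *)

Section Hopf.
Variables (K : fieldType) (g : lmodType K) (br : g -> g -> g).
Notation H := (env br).
Notation H2 := (ktens H H).
Notation H3 := (ktens H2 H).

(** Words in the generators span H. Splitting off the last letter suits the Hopf maps, whose values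
    at a product are determined by multiplicativity, with reversal for the antipode. *)
Lemma env_ind (Q : H -> Prop) :
  (forall c u v, Q u -> Q v -> Q (c *: u + v)) -> Q 1 ->
  (forall u z, Q u -> Q (u * Defs.iota br z)) -> forall u, Q u.
Proof.
move=> Ql Q1 Qz u.
have Q0 : Q 0 by have := Ql (-1) _ _ Q1 Q1; rewrite scaleN1r addNr.
have -> : u = \sum_(p <- repr u) p.1 *: \prod_(x <- p.2) Defs.iota br x.
  rewrite -{1}(env_repr u); elim: (repr u) => [|p s IH].
    rewrite big_nil; apply: envP => B f bf.
    by rewrite env_ext_class //.
  rewrite big_cons -IH; apply: envP => B f bf.
  rewrite env_ext_is_linear // !env_ext_class // /env_eval big_cons.
  congr (_ *: _ + _); elim: (p.2) => [|x t IHt].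
    by rewrite !big_nil env_ext1.
  by rewrite !big_cons env_extM // -IHt env_ext_iota.
elim: (repr u) => [|p s IH]; first by rewrite big_nil.
rewrite big_cons; apply: Ql => //.
elim/last_ind: (p.2) => [|t x IHt]; first by rewrite big_nil.
by rewrite -cats1 big_cat big_seq1; apply: Qz.
Qed.

Lemma Delta1 : Delta (1 : H) = kpure 1 1.
Proof. exact/env_ext1/Delta_lie. Qed.
Lemma DeltaM s t :
  @Delta K g br (s * t) = @Delta K g br s * @Delta K g br t.
Proof. exact/env_extM/Delta_lie. Qed.
Lemma Delta_iota z :
  Delta (Defs.iota br z) = kpure (Defs.iota br z) 1 + kpure 1 (Defs.iota br z).
Proof. exact/env_ext_iota/Delta_lie. Qed.
Lemma DeltaD s t :
  @Delta K g br (s + t) = @Delta K g br s + @Delta K g br t.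
Proof. by have := Delta_is_linear 1 s t; rewrite !scale1r. Qed.

Lemma DeltaZ c (u : H) : Delta (c *: u) = c *: Delta u.
Proof.
have D0 : Delta (0 : H) = 0.
  by apply: (addrI (Delta 0)); rewrite -DeltaD !addr0.
by have := Delta_is_linear c u 0; rewrite D0 !addr0.
Qed.

Lemma antipode_is_linear : linear (@antipode K g br).
Proof. exact: (env_ext_is_linear (antipode_lie br)). Qed.
HB.instance Definition _ :=
  GRing.isLinear.Build K H H _ (@antipode K g br) antipode_is_linear.
Lemma antipode1 : antipode (1 : H) = 1.
Proof. exact: (env_ext1 (antipode_lie br)). Qed.
Lemma antipodeM (u v : H) : antipode (u * v) = antipode v * antipode u.
Proof. exact: (env_extM (antipode_lie br)). Qed.
Lemma antipode_iota z : antipode (Defs.iota br z) = - Defs.iota br z.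
Proof. exact: (env_ext_iota (antipode_lie br)). Qed.

Lemma antipodeK : involutive (@antipode K g br).
Proof.
elim/env_ind => [c u v IHu IHv||u z IH]; first by rewrite !antipode_is_linear IHu IHv.
  by rewrite !antipode1.
rewrite antipodeM antipode_iota mulNr linearN /= antipodeM IH.
by rewrite antipode_iota mulrN opprK.
Qed.

Lemma counit1 : counit (1 : H) = 1.
Proof. exact: (env_ext1 (counit_lie br)). Qed.
Lemma counitM (u v : H) : counit (u * v) = counit u * counit v.
Proof. exact: (env_extM (counit_lie br)). Qed.
Lemma counit_iota z : counit (Defs.iota br z) = 0.
Proof. exact: (env_ext_iota (counit_lie br)). Qed.

Lemma counit_antipode (u : H) : counit (antipode u) = counit u.
Proof.
elim/env_ind: u => [c u v IHu IHv||u z IH].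
- by rewrite antipode_is_linear !counit_is_linear IHu IHv.
- by rewrite antipode1.
rewrite antipodeM antipode_iota !counitM counit_iota mulr0.
by rewrite -[counit (- _)]/(dual1 br _) linearN /= counit_iota oppr0 mul0r.
Qed.

Lemma Delta_id_lin (k : H) : linear (fun h : H => kpure (Delta h) k : H3).
Proof. by move=> c h h'; rewrite Delta_is_linear kpureDl kpureZl. Qed.
Lemma Delta_id_lin' (h : H) : linear (fun k : H => kpure (Delta h) k : H3).
Proof. by move=> c k k'; rewrite kpureDr kpureZr. Qed.

Lemma Delta_idE (h k : H) : Delta_id (kpure h k) = kpure (Delta h) k.
Proof. exact: klift_pure (Delta_id_lin) (Delta_id_lin'). Qed.

Lemma Delta_idD s t :
  @Delta_id K g br (s + t) = @Delta_id K g br s + @Delta_id K g br t.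
Proof. exact: (kliftD (Delta_id_lin) (Delta_id_lin') s t). Qed.

Lemma Delta_idM s t :
  @Delta_id K g br (s * t) = @Delta_id K g br s * @Delta_id K g br t.
Proof.
elim/ktens_ind: s => [s s' IH IH'|a b].
  by rewrite mulrDl !Delta_idD IH IH' mulrDl.
elim/ktens_ind: t => [t t' IH IH'|a' b'].
  by rewrite mulrDr !Delta_idD IH IH' mulrDr.
by rewrite kpureM !Delta_idE kpureM DeltaM.
Qed.

Lemma assoc_lin (h k'' : H) :
  linear (fun k' : H => kpure (kpure h k' : H2) k'' : H3).
Proof. by move=> c k k'; rewrite kpureDr kpureZr kpureDl kpureZl. Qed.
Lemma assoc_lin' (h k' : H) :
  linear (fun k'' : H => kpure (kpure h k' : H2) k'' : H3).
Proof. by move=> c k k''; rewrite kpureDr kpureZr. Qed.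

(** The reassociation H (x) (H (x) H) -> H^(x)3 with its first leg fixed. It is the inner map of
    [id_Delta], and [one_tens] is its case h = 1. *)
Definition tens_assoc (h : H) : H2 -> H3 :=
  klift (fun k' k'' => kpure (kpure h k' : H2) k'' : H3).

Lemma tens_assocE h k k' : tens_assoc h (kpure k k') = kpure (kpure h k) k'.
Proof. exact: klift_pure (assoc_lin h) (assoc_lin' h). Qed.
Lemma tens_assocD h s t :
  tens_assoc h (s + t) = tens_assoc h s + tens_assoc h t.
Proof. exact: (kliftD (assoc_lin h) (assoc_lin' h) s t). Qed.
Lemma tens_assoc_linear h : linear (tens_assoc h).
Proof. exact: klift_is_linear (assoc_lin h) (assoc_lin' h). Qed.

Lemma tens_assoc_linearl c : linear (tens_assoc^~ c).
Proof.
move=> a h h'; elim/ktens_ind: c => [s t IHs IHt|k k'].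
  by rewrite !tens_assocD IHs IHt scalerDr addrACA.
by rewrite !tens_assocE !kpureDl !kpureZl.
Qed.

Lemma tens_assocM h h' c c' :
  tens_assoc (h * h') (c * c') = tens_assoc h c * tens_assoc h' c'.
Proof.
elim/ktens_ind: c => [s s' IH IH'|a b].
  by rewrite mulrDl !tens_assocD IH IH' mulrDl.
elim/ktens_ind: c' => [t t' IH IH'|a' b'].
  by rewrite mulrDr !tens_assocD IH IH' mulrDr.
by rewrite kpureM !tens_assocE !kpureM.
Qed.

Lemma id_Delta_lin (k : H) : linear (fun h : H => tens_assoc h (Delta k)).
Proof. exact: tens_assoc_linearl. Qed.
Lemma id_Delta_lin' (h : H) : linear (fun k : H => tens_assoc h (Delta k)).
Proof. by move=> c k k'; rewrite Delta_is_linear tens_assoc_linear. Qed.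

Lemma id_DeltaE (h k : H) : id_Delta (kpure h k) = tens_assoc h (Delta k).
Proof. exact: klift_pure (id_Delta_lin) (id_Delta_lin'). Qed.

Lemma id_DeltaD s t :
  @id_Delta K g br (s + t) = @id_Delta K g br s + @id_Delta K g br t.
Proof. exact: (kliftD (id_Delta_lin) (id_Delta_lin') s t). Qed.

Lemma id_DeltaM s t :
  @id_Delta K g br (s * t) = @id_Delta K g br s * @id_Delta K g br t.
Proof.
elim/ktens_ind: s => [s s' IH IH'|a b].
  by rewrite mulrDl !id_DeltaD IH IH' mulrDl.
elim/ktens_ind: t => [t t' IH IH'|a' b'].
  by rewrite mulrDr !id_DeltaD IH IH' mulrDr.
by rewrite kpureM !id_DeltaE DeltaM tens_assocM.
Qed.

(** Both sides are multiplicative in h, and on a generator z both are the sum of the three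
    placements of z in H^(x)3. *)
Lemma Delta_coassoc (h : H) : Delta_id (Delta h) = id_Delta (Delta h).
Proof.
elim/env_ind: h => [c u v IHu IHv||u z IH].
- rewrite Delta_is_linear /Delta_id /id_Delta.
  rewrite (klift_is_linear Delta_id_lin Delta_id_lin').
  rewrite (klift_is_linear id_Delta_lin id_Delta_lin').
  by congr (_ *: _ + _).
- by rewrite Delta1 Delta_idE id_DeltaE Delta1 tens_assocE.
rewrite DeltaM Delta_idM id_DeltaM IH Delta_iota; congr (_ * _).
rewrite Delta_idD id_DeltaD !Delta_idE !id_DeltaE Delta1 Delta_iota.
by rewrite tens_assocD !tens_assocE kpureDl addrA.
Qed.

Lemma one_tensE (c : H2) : one_tens c = tens_assoc 1 c.
Proof. by []. Qed.
Lemma tens_oneM (c c' : H2) : tens_one (c * c') = tens_one c * tens_one c'.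
Proof. by rewrite /tens_one kpureM mulr1. Qed.
Lemma one_tensM (c c' : H2) : one_tens (c * c') = one_tens c * one_tens c'.
Proof. by rewrite !one_tensE -tens_assocM mulr1. Qed.
End Hopf.

(** * Contractions of tensor legs by elements of X *)

Section Contraction.
Variables (K : fieldType) (g : lmodType K) (br : g -> g -> g).
Notation H := (env br).
Notation H2 := (ktens H H).
Notation H3 := (ktens H2 H).
Notation X := (dual br).

Section LeftContraction.
Variables (phi : H -> K) (phiL : linear_for *%R phi).

Definition lcontr : H2 -> H := klift (fun a b => phi a *: b).

Lemma lcontr_lin (b : H) : linear (fun a : H => phi a *: b).
Proof. by move=> c a a'; rewrite phiL scalerDl -scalerA. Qed.
Lemma lcontr_lin' (a : H) : linear (fun b : H => phi a *: b).
Proof. by move=> c b b'; rewrite scalerDr !scalerA mulrC. Qed.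

Lemma lcontrE a b : lcontr (kpure a b) = phi a *: b.
Proof. exact: klift_pure lcontr_lin lcontr_lin'. Qed.
Lemma lcontr_is_linear : linear lcontr.
Proof. exact: klift_is_linear lcontr_lin lcontr_lin'. Qed.
Lemma lcontrD s t :
  lcontr (s + t) = lcontr s + lcontr t.
Proof. exact: (kliftD lcontr_lin lcontr_lin' s t). Qed.
End LeftContraction.

Lemma lcontr_comb (c : K) (phi psi chi : H -> K) t :
  linear_for *%R phi -> linear_for *%R psi -> linear_for *%R chi ->
  (forall h, chi h = c * phi h + psi h) ->
  lcontr chi t = c *: lcontr phi t + lcontr psi t.
Proof.
move=> phiL psiL chiL E; elim/ktens_ind: t => [s t IHs IHt|a b].
  by rewrite !lcontrD // IHs IHt scalerDr addrACA.
by rewrite !lcontrE // E scalerDl scalerA.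
Qed.

Definition rform (x : X) (u : H) : H -> K := fun h => x (h * u).

Lemma rform_lin x u : linear_for *%R (rform x u).
Proof. by move=> c h h'; rewrite /rform mulrDl -scalerAl linearP. Qed.

(* The right H-linear map H (x) H -> H with f (x) 1 |-> <S(x), f>, that is
   f (x) h |-> \sum <x, h_(1) S(f)> h_(2). *)
Definition contr (x : X) : H2 -> H :=
  klift (fun f h => lcontr (rform x (antipode f)) (Delta h)).

Lemma contr_lin x (h : H) :
  linear (fun f : H => lcontr (rform x (antipode f)) (Delta h)).
Proof.
move=> c f f'; apply: lcontr_comb; try exact: rform_lin.
by move=> k; rewrite /rform linearP mulrDr -scalerAr linearP.
Qed.
Lemma contr_lin' x (f : H) :
  linear (fun h : H => lcontr (rform x (antipode f)) (Delta h)).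
Proof.
by move=> c h h'; rewrite Delta_is_linear (lcontr_is_linear (rform_lin _ _)).
Qed.

Lemma contr_pure x f h :
  contr x (kpure f h) = lcontr (rform x (antipode f)) (Delta h).
Proof. exact: klift_pure (contr_lin x) (contr_lin' x). Qed.
Lemma contr_is_linear x : linear (contr x).
Proof. exact: klift_is_linear (contr_lin x) (contr_lin' x). Qed.
Lemma contrD x s t :
  contr x (s + t) = contr x s + contr x t.
Proof. exact: (kliftD (contr_lin x) (contr_lin' x) s t). Qed.
Lemma contrZ x c : {morph contr x : s / c *: s}.
Proof. exact: kliftZ (contr_lin x) (contr_lin' x) c. Qed.

Lemma contr_pure1 x f : contr x (kpure f 1) = (x (antipode f))%:A.
Proof. by rewrite contr_pure Delta1 lcontrE ?/rform ?mul1r //; apply: rform_lin. Qed.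

Lemma contr_comb c (x y z : X) t : (forall h, z h = c * x h + y h) ->
  contr z t = c *: contr x t + contr y t.
Proof.
move=> E; elim/ktens_ind: t => [s t IHs IHt|a b].
  by rewrite !contrD IHs IHt scalerDr addrACA.
rewrite !contr_pure; apply: lcontr_comb; try exact: rform_lin.
by move=> h; rewrite /rform E.
Qed.

(** A generator z sends f (x) h to f z (x) h + f (x) h z. The contraction of the first term is - <x,
    h_(1) z S(f)> h_(2), which cancels the part of Delta(h z) with z in the first leg; the rest is
    the contraction of f (x) h times z. *)
Lemma contrM x (c : H2) (k : H) : contr x (c * Delta k) = contr x c * k.
Proof.
elim/env_ind: k c => [d u v IHu IHv|| u z IH] c.
- by rewrite Delta_is_linear mulrDr -scalerAr contr_is_linear IHu IHv mulrDr
    -scalerAr.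
- by rewrite Delta1 !mulr1.
rewrite DeltaM mulrA mulrA -IH; move: (c * Delta u) => {IH u} c.
elim/ktens_ind: c => [s t IHs IHt|f h].
  by rewrite mulrDl !contrD IHs IHt mulrDl.
rewrite Delta_iota mulrDr !kpureM !mulr1 contrD !contr_pure.
rewrite DeltaM Delta_iota antipodeM antipode_iota.
elim/ktens_ind: (Delta h) => [s t IHs IHt|a b].
  rewrite mulrDl !(lcontrD (rform_lin _ _)) addrACA IHs IHt.
  by rewrite mulrDl.
rewrite mulrDr !kpureM !mulr1 (lcontrD (rform_lin _ _)).
rewrite !(lcontrE (rform_lin _ _)) addrA -scalerDl.
by rewrite /rform mulNr mulrN linearN mulrA addNr scale0r add0r scalerAl.
Qed.

Definition contr12 (x : X) : H3 -> H2 :=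
  klift (fun c h => kpure (contr x c) h).

Lemma contr12_lin x (h : H) : linear (fun c : H2 => kpure (contr x c) h).
Proof. by move=> a c c'; rewrite contr_is_linear kpureDl kpureZl. Qed.
Lemma contr12_lin' x (c : H2) : linear (fun h : H => kpure (contr x c) h).
Proof. by move=> a h h'; rewrite kpureDr kpureZr. Qed.

Lemma contr12_pure x c h : contr12 x (kpure c h) = kpure (contr x c) h.
Proof. exact: klift_pure (contr12_lin x) (contr12_lin' x). Qed.
Lemma contr12D x s t :
  contr12 x (s + t) = contr12 x s + contr12 x t.
Proof. exact: (kliftD (contr12_lin x) (contr12_lin' x) s t). Qed.

(** By [contrM] the [Delta] inside [Delta_id] is absorbed. For d = Delta(h) this turns the action of
    H on H^(x)3 into the action on H (x) H, so that [contr12] passes to tensor products over H. *)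
Lemma contr12M x (c : H3) (d : H2) :
  contr12 x (c * Delta_id d) = contr12 x c * d.
Proof.
elim/ktens_ind: c => [s t IHs IHt|c h].
  by rewrite mulrDl !contr12D IHs IHt mulrDl.
elim/ktens_ind: d => [s t IHs IHt|a b].
  by rewrite Delta_idD mulrDr contr12D IHs IHt mulrDr.
by rewrite Delta_idE !kpureM !contr12_pure contrM kpureM.
Qed.

Definition contr23_aux (x : X) (h : H) : H2 -> H2 :=
  klift (fun f k => kpure f (contr x (kpure k h))).
Lemma contr23_aux_lin x (h k : H) :
  linear (fun f : H => kpure f (contr x (kpure k h))).
Proof. by move=> a c c'; rewrite kpureDl kpureZl. Qed.
Lemma contr23_aux_lin' x (h f : H) :
  linear (fun k : H => kpure f (contr x (kpure k h))).
Proof.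
by move=> a c c'; rewrite kpureDl kpureZl contr_is_linear kpureDr kpureZr.
Qed.
Lemma contr23_auxE x h f k :
  contr23_aux x h (kpure f k) = kpure f (contr x (kpure k h)).
Proof. exact: klift_pure (contr23_aux_lin x h) (contr23_aux_lin' x h). Qed.
Lemma contr23_auxD x h s t :
  contr23_aux x h (s + t) = contr23_aux x h s + contr23_aux x h t.
Proof. exact: (kliftD (contr23_aux_lin x h) (contr23_aux_lin' x h) s t). Qed.

Definition contr23 (x : X) : H3 -> H2 :=
  klift (fun c h => contr23_aux x h c).

Lemma contr23_lin x (h : H) : linear (fun c : H2 => contr23_aux x h c).
Proof. exact: klift_is_linear (contr23_aux_lin x h) (contr23_aux_lin' x h). Qed.
Lemma contr23_lin' x (c : H2) : linear (fun h : H => contr23_aux x h c).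
Proof.
move=> a h h'; elim/ktens_ind: c => [s t IHs IHt|f k].
  by rewrite !contr23_auxD IHs IHt scalerDr addrACA.
by rewrite !contr23_auxE kpureDr kpureZr contr_is_linear kpureDr kpureZr.
Qed.

Lemma contr23_pure x f k h :
  contr23 x (kpure (kpure f k) h) = kpure f (contr x (kpure k h)).
Proof.
rewrite -contr23_auxE; exact: klift_pure (contr23_lin x) (contr23_lin' x).
Qed.
Lemma contr23D x s t :
  contr23 x (s + t) = contr23 x s + contr23 x t.
Proof. exact: (kliftD (contr23_lin x) (contr23_lin' x) s t). Qed.

Lemma contr23_is_linear x : linear (contr23 x).
Proof. exact: klift_is_linear (contr23_lin x) (contr23_lin' x). Qed.

Lemma contr23_assoc x f (c : H2) : contr23 x (tens_assoc f c) = kpure f (contr x c).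
Proof.
elim/ktens_ind: c => [s t IHs IHt|k h].
  by rewrite tens_assocD contr23D IHs IHt contrD kpureDr.
by rewrite tens_assocE contr23_pure.
Qed.

(** Generators in the other bracketing f (x) c, on which [contr23] is simply [contr] applied to
    c. *)
Lemma ktens3_ind (Q : H3 -> Prop) : (forall s t, Q s -> Q t -> Q (s + t)) ->
  (forall f c, Q (tens_assoc f c)) -> forall t, Q t.
Proof.
move=> QD Qp; apply: ktens_ind => // c h.
elim/ktens_ind: c => [s t IHs IHt|f k]; first by rewrite kpureDl; apply: QD.
by rewrite -tens_assocE.
Qed.

Lemma contr23M x (c : H3) (d : H2) :
  contr23 x (c * id_Delta d) = contr23 x c * d.
Proof.
elim/ktens3_ind: c => [s t IHs IHt|f c].
  by rewrite mulrDl !contr23D IHs IHt mulrDl.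
elim/ktens_ind: d => [s t IHs IHt|a b].
  by rewrite id_DeltaD mulrDr contr23D IHs IHt mulrDr.
by rewrite id_DeltaE -tens_assocM !contr23_assoc contrM kpureM.
Qed.
End Contraction.

(** * Contractions on tensor products over H *)

Section TensorOverH.
Variables (K : fieldType) (g : lmodType K) (br : g -> g -> g).
Notation H := (env br).
Notation H2 := (ktens H H).
Notation H3 := (ktens H2 H).
Notation X := (dual br).
Variables (V : lmodType H).

Lemma pure2Dl (c d : H2) (v : V) : pure2 (c + d) v = pure2 c v + pure2 d v.
Proof. exact: balancedDl (tpure_balanced _ _) _ _ _. Qed.
Lemma pure2Dr (c : H2) (v w : V) : pure2 c (v + w) = pure2 c v + pure2 c w.
Proof. exact: balancedDr (tpure_balanced _ _) _ _ _. Qed.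
Lemma pure2M (c : H2) h (v : V) : pure2 (c * Delta h) v = pure2 c (h *: v).
Proof. exact: balancedM (tpure_balanced _ _) _ _ _. Qed.
Lemma pure3Dl (c d : H3) (v : V) : pure3 (c + d) v = pure3 c v + pure3 d v.
Proof. exact: balancedDl (tpure_balanced _ _) _ _ _. Qed.
Lemma pure3Dr (c : H3) (v w : V) : pure3 c (v + w) = pure3 c v + pure3 c w.
Proof. exact: balancedDr (tpure_balanced _ _) _ _ _. Qed.
Lemma pure3M (c : H3) h (v : V) :
  pure3 (c * Delta_id (Delta h)) v = pure3 c (h *: v).
Proof. exact: balancedM (tpure_balanced _ _) _ _ _. Qed.

Lemma pure2_0r (c : H2) : pure2 c (0 : V) = 0.
Proof. by apply: (addrI (pure2 c 0)); rewrite -pure2Dr !addr0. Qed.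

Lemma pure2_sumr (I : Type) (r : seq I) c (F : I -> V) :
  pure2 c (\sum_(i <- r) F i) = \sum_(i <- r) pure2 c (F i).
Proof. exact: (big_morph _ (pure2Dr c) (pure2_0r c)). Qed.

Lemma pure2_suml (I : Type) (r : seq I) (F : I -> H2) (v : V) :
  pure2 (\sum_(i <- r) F i) v = \sum_(i <- r) pure2 (F i) v.
Proof.
have pure20 : pure2 0 v = 0.
  by apply: (addrI (pure2 0 v)); rewrite -pure2Dl !addr0.
exact: (big_morph (fun c => pure2 c v) (fun c d => pure2Dl c d v) pure20).
Qed.

Lemma pure2Z (c : K) (d : H2) (v : V) : pure2 (c *: d) v = pure2 d (c%:A *: v).
Proof. by rewrite -pure2M DeltaZ Delta1 -scalerAr mulr1. Qed.

Lemma tens2_ind (Q : tens2 V -> Prop) :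
  Q 0 -> (forall s t, Q s -> Q t -> Q (s + t)) ->
  (forall c v, Q (pure2 c v)) -> forall t, Q t.
Proof. exact: tens_ind. Qed.

(** The second leg can be emptied letter by letter: f (x) u z = (f (x) u) Delta(z) - f z (x) u,
    where the first term passes z on to the module element. The first leg and the module element
    change on the way, so the induction on h runs over all f and v. *)
Lemma tens2_normal (t : tens2 V) :
  exists s : seq (H * V), t = \sum_(p <- s) pure2 (kpure p.1 1) p.2.
Proof.
pose Q (t : tens2 V) :=
  exists s : seq (H * V), t = \sum_(p <- s) pure2 (kpure p.1 1) p.2.
have QD s1 s2 : Q s1 -> Q s2 -> Q (s1 + s2).
  by move=> [r1 ->] [r2 ->]; exists (r1 ++ r2); rewrite big_cat.
have Q1 f v : Q (pure2 (kpure f 1) v) by exists [:: (f, v)]; rewrite big_seq1.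
elim/tens2_ind: t => [||c v]; [by exists [::]; rewrite big_nil|exact: QD|].
rewrite -/(Q _); elim/ktens_ind: c => [s t Qs Qt|f h].
  by rewrite pure2Dl; apply: QD.
elim/env_ind: h f v => [c u w Qu Qw||u z IH] f v //.
  rewrite kpureDr kpureZr pure2Dl pure2Z; apply: QD => //; exact: Qu.
have -> : kpure f (u * Defs.iota br z)
  = kpure f u * Delta (Defs.iota br z) + kpure (- (f * Defs.iota br z)) u.
  rewrite Delta_iota mulrDr !kpureM !mulr1 addrC addrA -kpureDl addNr.
  by rewrite -(scale0r (0 : H)) kpureZl scale0r add0r.
by rewrite pure2Dl pure2M; apply: QD; apply: IH.
Qed.

(* Sends (f (x) 1) (x)_H v to <S(x), f> v, so that a_x b is the image of a * b. *)
Definition tcontr (x : X) (t : tens2 V) : V := tlift (fun c v => contr x c *: v) t.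

Lemma tcontr_balanced x :
  balanced (@act2 K g br) (fun c (v : V) => contr x c *: v).
Proof.
split=> [c d v|c v w|c h v]; first by rewrite contrD scalerDl.
  by rewrite scalerDr.
by rewrite /act2 contrM scalerA.
Qed.
Lemma tcontrE x c v : tcontr x (pure2 c v) = contr x c *: v.
Proof. exact/tliftE/tcontr_balanced. Qed.
Lemma tcontrD x s t :
  tcontr x (s + t) = tcontr x s + tcontr x t.
Proof. exact/tliftD/tcontr_balanced. Qed.
Lemma tcontr0 x : tcontr x 0 = 0.
Proof. exact/tlift0/tcontr_balanced. Qed.
Lemma tcontr_sum x (I : Type) (r : seq I) (F : I -> tens2 V) :
  tcontr x (\sum_(i <- r) F i) = \sum_(i <- r) tcontr x (F i).
Proof. exact: (big_morph _ (tcontrD x) (tcontr0 x)). Qed.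

Lemma tcontr_normal x (s : seq (H * V)) :
  tcontr x (\sum_(p <- s) pure2 (kpure p.1 1) p.2) =
  \sum_(p <- s) (x (antipode p.1))%:A *: p.2.
Proof.
by rewrite tcontr_sum; apply: eq_bigr => p _; rewrite tcontrE contr_pure1.
Qed.

(** [xprod] evaluates one chosen normal expression. [tcontr] is defined on the whole tensor product
    and has the prescribed value on every normal expression, so the choice is immaterial. *)
Lemma xprodE (pp : pseudoproduct V) x a b : xprod pp x a b = tcontr x (pp a b).
Proof.
rewrite /xprod; case: xgetP => [s _ /= ->|no]; first by rewrite tcontr_normal.
by have [s sE] := tens2_normal (pp a b); case: (no s).
Qed.

Lemma tcontr_comb c (x y z : X) t : (forall h, z h = c * x h + y h) ->
  tcontr z t = c%:A *: tcontr x t + tcontr y t.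
Proof.
move=> E; elim/tens2_ind: t => [|s t IHs IHt|d v].
- by rewrite !tcontr0 scaler0 addr0.
- by rewrite !tcontrD IHs IHt scalerDr addrACA.
by rewrite !tcontrE (contr_comb _ E) scalerDl -[c *: _]mul1r -scalerAr scalerA scalerAl.
Qed.

Definition tcontr12 (x : X) (t : tens3 V) : tens2 V :=
  tlift (fun c v => pure2 (contr12 x c) v) t.
Definition tcontr23 (x : X) (t : tens3 V) : tens2 V :=
  tlift (fun c v => pure2 (contr23 x c) v) t.

Lemma tcontr12_balanced x :
  balanced (@act3 K g br) (fun c (v : V) => pure2 (contr12 x c) v).
Proof.
split=> [c d v|c v w|c h v]; first by rewrite contr12D pure2Dl.
  by rewrite pure2Dr.
by rewrite /act3 contr12M pure2M.
Qed.
Lemma tcontr12E x c v : tcontr12 x (pure3 c v) = pure2 (contr12 x c) v.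
Proof. exact/tliftE/tcontr12_balanced. Qed.
Lemma tcontr12D x s t :
  tcontr12 x (s + t) = tcontr12 x s + tcontr12 x t.
Proof. exact/tliftD/tcontr12_balanced. Qed.
Lemma tcontr12_0 x : tcontr12 x 0 = 0.
Proof. exact/tlift0/tcontr12_balanced. Qed.

Lemma tcontr23_balanced x :
  balanced (@act3 K g br) (fun c (v : V) => pure2 (contr23 x c) v).
Proof.
split=> [c d v|c v w|c h v]; first by rewrite contr23D pure2Dl.
  by rewrite pure2Dr.
(* [act3] is given by [Delta_id], while [contr23] is compatible with [id_Delta]; coassociativity
   passes from one to the other. *)
by rewrite /act3 Delta_coassoc contr23M pure2M.
Qed.
Lemma tcontr23E x c v : tcontr23 x (pure3 c v) = pure2 (contr23 x c) v.
Proof. exact/tliftE/tcontr23_balanced. Qed.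
Lemma tcontr23D x s t :
  tcontr23 x (s + t) = tcontr23 x s + tcontr23 x t.
Proof. exact/tliftD/tcontr23_balanced. Qed.
Lemma tcontr23_0 x : tcontr23 x 0 = 0.
Proof. exact/tlift0/tcontr23_balanced. Qed.

Lemma lmul2_balanced (c : H2) :
  balanced (@act2 K g br) (fun b (v : V) => pure2 (c * b) v).
Proof.
split=> [b d v|b v w|b h v]; first by rewrite mulrDr pure2Dl.
  by rewrite pure2Dr.
by rewrite /act2 mulrA pure2M.
Qed.
Lemma lmul2E (c b : H2) (v : V) : lmul2 c (pure2 b v) = pure2 (c * b) v.
Proof. exact/tliftE/lmul2_balanced. Qed.
Lemma lmul2D c s t :
  @lmul2 K g br V c (s + t) = @lmul2 K g br V c s + @lmul2 K g br V c t.
Proof. exact/tliftD/lmul2_balanced. Qed.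
Lemma lmul2_0 c : lmul2 c (0 : tens2 V) = 0.
Proof. exact/tlift0/lmul2_balanced. Qed.
Lemma lmul2_sum c (I : Type) (r : seq I) (F : I -> tens2 V) :
  lmul2 c (\sum_(i <- r) F i) = \sum_(i <- r) lmul2 c (F i).
Proof. exact: (big_morph _ (lmul2D c) (lmul2_0 c)). Qed.
End TensorOverH.

(** * Maps induced by H-linear maps *)

Section Map2.
Variables (K : fieldType) (g : lmodType K) (br : g -> g -> g).
Notation H := (env br).
Notation H2 := (ktens H H).
Variables (V W : lmodType H) (phi : V -> W) (phiL : linear phi).

Let phiD : {morph phi : v w / v + w}.
Proof. by move=> v w; have := phiL 1 v w; rewrite !scale1r. Qed.
Let phi0 : phi 0 = 0.
Proof. by apply: (addrI (phi 0)); rewrite -phiD !addr0. Qed.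
Let phiZ h : {morph phi : v / h *: v}.
Proof. by move=> v; have := phiL h v 0; rewrite phi0 !addr0. Qed.

Lemma map2_balanced :
  balanced (@act2 K g br) (fun b (v : V) => pure2 b (phi v)).
Proof.
split=> [c d v|c v w|c h v]; first by rewrite pure2Dl.
  by rewrite phiD pure2Dr.
by rewrite /act2 pure2M phiZ.
Qed.
Lemma map2E (b : H2) (v : V) : map2 phi (pure2 b v) = pure2 b (phi v).
Proof. exact/tliftE/map2_balanced. Qed.
Lemma map2D s t :
  @map2 K g br V W phi (s + t) = @map2 K g br V W phi s + @map2 K g br V W phi t.
Proof. exact/tliftD/map2_balanced. Qed.
Lemma map2_0 : map2 phi (0 : tens2 V) = 0.
Proof. exact/tlift0/map2_balanced. Qed.

Lemma map2_lmul2 (c : H2) (t : tens2 V) :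
  map2 phi (lmul2 c t) = lmul2 c (map2 phi t).
Proof.
elim/tens2_ind: t => [|s t IHs IHt|b v]; first by rewrite ?(lmul2_0, map2_0).
  by rewrite !(lmul2D, map2D) IHs IHt.
by rewrite !(lmul2E, map2E).
Qed.

Lemma tcontr_map2 x (t : tens2 V) : tcontr x (map2 phi t) = phi (tcontr x t).
Proof.
elim/tens2_ind: t => [|s t IHs IHt|b v].
- by rewrite map2_0 !tcontr0 phi0.
- by rewrite map2D !tcontrD IHs IHt phiD.
by rewrite map2E !tcontrE phiZ.
Qed.
End Map2.

(** * The two sides of associativity under contraction *)

Section PseudoproductContraction.
Variables (K : fieldType) (g : lmodType K) (br : g -> g -> g).
Notation H := (env br).
Notation H2 := (ktens H H).
Notation H3 := (ktens H2 H).
Notation X := (dual br).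
Variables (V : lmodType H).

(** With [lift_r], one term (c (x)_H d) * w or w * (c (x)_H d) as a function of the inner product t.
    Making t a variable allows the balance in c and d to be checked on pure tensors. *)
Definition lift_l (c : H2) (t : tens2 V) : tens3 V :=
  tlift (fun b v => pure3 (tens_one c * Delta_id b) v) t.
Definition lift_r (c : H2) (t : tens2 V) : tens3 V :=
  tlift (fun b v => pure3 (one_tens c * id_Delta b) v) t.

Lemma lift_l_balanced (c : H2) : balanced (@act2 K g br)
  (fun b (v : V) => pure3 (tens_one c * Delta_id b) v).
Proof.
split=> [b d v|b v w|b h v].
- by rewrite Delta_idD mulrDr pure3Dl.
- by rewrite pure3Dr.
by rewrite /act2 Delta_idM mulrA pure3M.
Qed.
Lemma lift_lE c b v : lift_l c (pure2 b v) = pure3 (tens_one c * Delta_id b) v.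
Proof. exact/tliftE/lift_l_balanced. Qed.
Lemma lift_lD c s t :
  lift_l c (s + t) = lift_l c s + lift_l c t.
Proof. exact/tliftD/lift_l_balanced. Qed.
Lemma lift_l0 c : lift_l c 0 = 0.
Proof. exact/tlift0/lift_l_balanced. Qed.

Lemma lift_r_balanced (c : H2) : balanced (@act2 K g br)
  (fun b (v : V) => pure3 (one_tens c * id_Delta b) v).
Proof.
split=> [b d v|b v w|b h v].
- by rewrite id_DeltaD mulrDr pure3Dl.
- by rewrite pure3Dr.
by rewrite /act2 id_DeltaM mulrA -Delta_coassoc pure3M.
Qed.
Lemma lift_rE c b v : lift_r c (pure2 b v) = pure3 (one_tens c * id_Delta b) v.
Proof. exact/tliftE/lift_r_balanced. Qed.
Lemma lift_rD c s t :
  lift_r c (s + t) = lift_r c s + lift_r c t.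
Proof. exact/tliftD/lift_r_balanced. Qed.
Lemma lift_r0 c : lift_r c 0 = 0.
Proof. exact/tlift0/lift_r_balanced. Qed.

Lemma lift_lDl c d t : lift_l (c + d) t = lift_l c t + lift_l d t.
Proof.
elim/tens2_ind: t => [|s t IHs IHt|b v]; first by rewrite !lift_l0 addr0.
  by rewrite !lift_lD IHs IHt addrACA.
by rewrite !lift_lE /tens_one kpureDl mulrDl pure3Dl.
Qed.
Lemma lift_rDl c d t : lift_r (c + d) t = lift_r c t + lift_r d t.
Proof.
elim/tens2_ind: t => [|s t IHs IHt|b v]; first by rewrite !lift_r0 addr0.
  by rewrite !lift_rD IHs IHt addrACA.
by rewrite !lift_rE !one_tensE tens_assocD mulrDl pure3Dl.
Qed.

Lemma lift_lM c k t : lift_l (c * Delta k) t = lift_l c (lmul2 (kpure k 1) t).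
Proof.
elim/tens2_ind: t => [|s t IHs IHt|b v]; first by rewrite lmul2_0 !lift_l0.
  by rewrite lmul2D !lift_lD IHs IHt.
by rewrite lmul2E !lift_lE Delta_idM Delta_idE mulrA tens_oneM.
Qed.
Lemma lift_rM c k t : lift_r (c * Delta k) t = lift_r c (lmul2 (kpure 1 k) t).
Proof.
elim/tens2_ind: t => [|s t IHs IHt|b v]; first by rewrite lmul2_0 !lift_r0.
  by rewrite lmul2D !lift_rD IHs IHt.
by rewrite lmul2E !lift_rE id_DeltaM id_DeltaE mulrA one_tensM.
Qed.

Lemma tcontr12_lift_l x c t :
  tcontr12 x (lift_l c t) = lmul2 (kpure (contr x c) 1) t.
Proof.
elim/tens2_ind: t => [|s t IHs IHt|b v].
- by rewrite lift_l0 tcontr12_0 lmul2_0.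
- by rewrite lift_lD tcontr12D IHs IHt lmul2D.
by rewrite lift_lE tcontr12E lmul2E contr12M contr12_pure.
Qed.

Lemma tcontr23_lift_r x c t :
  tcontr23 x (lift_r c t) = lmul2 (kpure 1 (contr x c)) t.
Proof.
elim/tens2_ind: t => [|s t IHs IHt|b v].
- by rewrite lift_r0 tcontr23_0 lmul2_0.
- by rewrite lift_rD tcontr23D IHs IHt lmul2D.
by rewrite lift_rE tcontr23E lmul2E contr23M one_tensE contr23_assoc.
Qed.

(** Contracting legs 2, 3 of a left-nested product splits a by [Delta]: its first half stays in
    front, its second half is paired with x. *)
Lemma tcontr23_lift_l x f (a : H) (v : V) :
  tcontr23 x (lift_l (kpure f 1) (pure2 (kpure a 1) v)) =
  pure2 (kpure f 1 * contr23 x (kpure (Delta a) 1)) v.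
Proof.
rewrite lift_lE tcontr23E Delta_idE /tens_one kpureM mulr1; congr (pure2 _ v).
elim/ktens_ind: (Delta a) => [s t IHs IHt|k k'].
  by rewrite mulrDr !kpureDl !contr23D IHs IHt mulrDr.
by rewrite kpureM !contr23_pure mul1r kpureM mul1r.
Qed.

Variables (pp : pseudoproduct V) (ppb : is_bilinear_pp pp).

Lemma pp_Zl h a b : pp (h *: a) b = lmul2 (kpure h 1) (pp a b).
Proof. by rewrite -(ppH ppb) scale1r. Qed.
Lemma pp_Zr h a b : pp a (h *: b) = lmul2 (kpure 1 h) (pp a b).
Proof. by rewrite -(ppH ppb) scale1r. Qed.
Lemma pp_0l b : pp 0 b = 0.
Proof. by apply: (addrI (pp 0 b)); rewrite -(ppDl ppb) !addr0. Qed.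
Lemma pp_0r a : pp a 0 = 0.
Proof. by apply: (addrI (pp a 0)); rewrite -(ppDr ppb) !addr0. Qed.

Lemma pp_suml (I : Type) (r : seq I) (F : I -> V) b :
  pp (\sum_(i <- r) F i) b = \sum_(i <- r) pp (F i) b.
Proof.
exact: (big_morph (fun v => pp v b) (fun v w => ppDl ppb v w b) (pp_0l b)).
Qed.

Lemma pp_l_balanced w :
  balanced (@act2 K g br) (fun c d => lift_l c (pp d w)).
Proof.
split=> [c d v|c v u|c h v]; first exact: lift_lDl.
  by rewrite (ppDl ppb) lift_lD.
by rewrite /act2 lift_lM pp_Zl.
Qed.
Lemma pp_lE c d w : pp_l pp (pure2 c d) w = lift_l c (pp d w).
Proof. exact: tliftE (pp_l_balanced w). Qed.
Lemma pp_lD w s t : pp_l pp (s + t) w = pp_l pp s w + pp_l pp t w.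
Proof. exact: (tliftD (pp_l_balanced w) s t). Qed.
Lemma pp_l0 w : pp_l pp 0 w = 0.
Proof. exact: tlift0 (pp_l_balanced w). Qed.

Lemma pp_r_balanced w :
  balanced (@act2 K g br) (fun c d => lift_r c (pp w d)).
Proof.
split=> [c d v|c v u|c h v]; first exact: lift_rDl.
  by rewrite (ppDr ppb) lift_rD.
by rewrite /act2 lift_rM pp_Zr.
Qed.
Lemma pp_rE c d w : pp_r pp w (pure2 c d) = lift_r c (pp w d).
Proof. exact: tliftE (pp_r_balanced w). Qed.
Lemma pp_rD w s t :
  pp_r pp w (s + t) = pp_r pp w s + pp_r pp w t.
Proof. exact: (tliftD (pp_r_balanced w) s t). Qed.
Lemma pp_r0 w : pp_r pp w 0 = 0.
Proof. exact: tlift0 (pp_r_balanced w). Qed.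

Lemma tcontr12_pp_l x t w : tcontr12 x (pp_l pp t w) = pp (tcontr x t) w.
Proof.
elim/tens2_ind: t => [|s t IHs IHt|c v].
- by rewrite pp_l0 tcontr12_0 tcontr0 pp_0l.
- by rewrite pp_lD tcontr12D IHs IHt tcontrD (ppDl ppb).
by rewrite pp_lE tcontr12_lift_l tcontrE pp_Zl.
Qed.

Lemma tcontr23_pp_r x w t : tcontr23 x (pp_r pp w t) = pp w (tcontr x t).
Proof.
elim/tens2_ind: t => [|s t IHs IHt|c v].
- by rewrite pp_r0 tcontr23_0 tcontr0 pp_0r.
- by rewrite pp_rD tcontr23D IHs IHt tcontrD (ppDr ppb).
by rewrite pp_rE tcontr23_lift_r tcontrE pp_Zr.
Qed.

Lemma tcontr_ppZl x c a b : tcontr x (pp (c%:A *: a) b) = c%:A *: tcontr x (pp a b).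
Proof.
rewrite pp_Zl kpureZl; elim/tens2_ind: (pp a b) => [|s t IHs IHt|d v].
- by rewrite lmul2_0 !tcontr0 scaler0.
- by rewrite lmul2D !tcontrD IHs IHt scalerDr.
by rewrite lmul2E !tcontrE -scalerAl mul1r contrZ scalerA -scalerAl mul1r.
Qed.
Lemma tcontr_ppZr x c a b : tcontr x (pp a (c%:A *: b)) = c%:A *: tcontr x (pp a b).
Proof.
rewrite pp_Zr kpureZr; elim/tens2_ind: (pp a b) => [|s t IHs IHt|d v].
- by rewrite lmul2_0 !tcontr0 scaler0.
- by rewrite lmul2D !tcontrD IHs IHt scalerDr.
by rewrite lmul2E !tcontrE -scalerAl mul1r contrZ scalerA -scalerAl mul1r.
Qed.
End PseudoproductContraction.

(** * Convolution in X, the counit, and finite-rank identities *)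

Section DualConvolution.
Variables (K : fieldType) (g : lmodType K) (br : g -> g -> g).
Notation H := (env br).
Notation H2 := (ktens H H).
Notation X := (dual br).
Implicit Types x y : X.

Lemma dual_linear x : linear_for *%R x.
Proof. exact: linearP. Qed.

Lemma dualME x y h : dualM x y h = y (lcontr x (Delta h)).
Proof.
pose f (h1 h2 : H) := x h1 * y h2 : K^o.
have fl h2 : linear (f^~ h2).
  by move=> c k k'; rewrite /f linearP mulrDl -mulrA.
have fr h1 : linear (f h1).
  by move=> c k k'; rewrite /f linearP mulrDr mulrCA.
rewrite -[LHS]/(klift f (Delta h)).
elim/ktens_ind: (Delta h) => [s t IHs IHt|a b].
  by rewrite (kliftD fl fr) IHs IHt (lcontrD (dual_linear x)) linearD.
by rewrite (klift_pure _ _ fl fr) (lcontrE (dual_linear x)) linearZ.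
Qed.

Lemma lcontr_counit (h : H) : lcontr (dual1 br) (Delta h) = h.
Proof.
have L := dual_linear (dual1 br).
elim/env_ind: h => [c u v IHu IHv||u z IH].
- by rewrite Delta_is_linear (lcontr_is_linear L) IHu IHv.
- by rewrite Delta1 (lcontrE L) /= counit1 scale1r.
rewrite DeltaM -{2}IH; elim/ktens_ind: (Delta u) => [s t IHs IHt|a b].
  by rewrite mulrDl !(lcontrD L) IHs IHt mulrDl.
rewrite Delta_iota mulrDr !kpureM !mulr1 (lcontrD L) !(lcontrE L) /=.
by rewrite counitM counit_iota mulr0 scale0r add0r scalerAl.
Qed.

Lemma dual1M x : dualM (dual1 br) x = x.
Proof. by apply: dual_ext => h; rewrite dualME lcontr_counit. Qed.

Definition antipode2 : H2 -> H2 :=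
  klift (fun a b => kpure (antipode a) (antipode b)).

Lemma antipode2_lin (b : H) :
  linear (fun a : H => kpure (antipode a) (antipode b)).
Proof. by move=> c a a'; rewrite antipode_is_linear kpureDl kpureZl. Qed.
Lemma antipode2_lin' (a : H) :
  linear (fun b : H => kpure (antipode a) (antipode b)).
Proof. by move=> c b b'; rewrite antipode_is_linear kpureDr kpureZr. Qed.
Lemma antipode2E a b : antipode2 (kpure a b) = kpure (antipode a) (antipode b).
Proof. exact: klift_pure antipode2_lin antipode2_lin'. Qed.
Lemma antipode2D s t :
  antipode2 (s + t) = antipode2 s + antipode2 t.
Proof. exact: (kliftD antipode2_lin antipode2_lin' s t). Qed.
Lemma antipode2_is_linear : linear antipode2.
Proof. exact: klift_is_linear antipode2_lin antipode2_lin'. Qed.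

(* H being cocommutative, no flip is needed. *)
Lemma Delta_antipode (h : H) : Delta (antipode h) = antipode2 (Delta h).
Proof.
elim/env_ind: h => [c u v IHu IHv||u z IH].
- by rewrite antipode_is_linear !Delta_is_linear antipode2_is_linear IHu IHv.
- by rewrite antipode1 Delta1 antipode2E antipode1.
rewrite antipodeM antipode_iota !DeltaM IH.
elim/ktens_ind: (Delta u) => [s t IHs IHt|a b].
  by rewrite antipode2D mulrDr IHs IHt mulrDl antipode2D.
rewrite antipode2E -scaleN1r DeltaZ Delta_iota mulrDr antipode2D !kpureM.
rewrite !antipode2E !antipodeM antipode_iota antipode1 -scalerAl mulrDl.
by rewrite !kpureM !mul1r scalerDr -kpureZl -kpureZr !scaleN1r !mulNr.
Qed.

(** Both contractions pair through S, hence [antipode2]. The outer y meets the first leg of t and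
    the inner x the second, which fixes the order in the product [dualM y x] below. *)
Lemma contr_contr23 x y t :
  contr y (contr23 x (kpure t 1)) = (x (lcontr y (antipode2 t)))%:A.
Proof.
have L := dual_linear y.
elim/ktens_ind: t => [s t IHs IHt|a b].
  rewrite kpureDl contr23D contrD IHs IHt antipode2D (lcontrD L) linearD.
  by rewrite scalerDl.
rewrite contr23_pure contr_pure1 kpureZr contrZ contr_pure1 antipode2E.
rewrite (lcontrE L).
have -> c u : x (c *: u) = c * x u by exact: linearZ.
by rewrite scalerA mulrC.
Qed.

Lemma contr_contr23_Delta x y h :
  contr y (contr23 x (kpure (Delta h) 1)) = contr (dualM y x) (kpure h 1).
Proof. by rewrite contr_contr23 contr_pure1 dualME Delta_antipode. Qed.

(** The counit axiom for the second leg of [Delta], with an idle third leg. The antipode inside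
    [contr] disappears because the counit is invariant under S. *)
Lemma contr23_counit (h : H) :
  contr23 (dual1 br) (kpure (Delta h) 1) = kpure h 1.
Proof.
elim/env_ind: h => [c u v IHu IHv||u z IH].
- rewrite Delta_is_linear kpureDl kpureZl kpureDl kpureZl.
  by rewrite contr23_is_linear IHu IHv.
- by rewrite Delta1 contr23_pure contr_pure1 antipode1 /= counit1 scale1r.
have -> : kpure (u * Defs.iota br z) (1 : H) =
  (kpure u 1 : H2) * kpure (Defs.iota br z) 1.
  by rewrite kpureM mulr1.
rewrite DeltaM -IH; elim/ktens_ind: (Delta u) => [s t IHs IHt|a b].
  by rewrite mulrDl !kpureDl !contr23D IHs IHt mulrDl.
rewrite Delta_iota mulrDr !kpureM !mulr1 kpureDl contr23D !contr23_pure.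
rewrite !contr_pure1 /= !counit_antipode counitM counit_iota mulr0 scale0r.
by rewrite -[X in _ + kpure _ X](scale0r 1) !kpureZr scale0r addr0 -scalerAl
  kpureM mul1r.
Qed.

Fact dualS_subproof x : linear_for *%R (fun h : H => x (antipode h)).
Proof. by move=> c u v; rewrite antipode_is_linear linearP. Qed.
Definition dualS x : X := dual_of (dualS_subproof x).

(** Stands in for coordinates in a basis. If P is the operator built for s and v = u - P(u) is not
    0, the term f(.) v is added, where f = phi o (1 - P) and phi(v) = 1; f vanishes on s because P
    fixes s. *)
Lemma finite_rank_identity (s : seq H) :
  exists r : seq (X * H), forall u, u \in s -> u = \sum_(p <- r) p.1 u *: p.2.
Proof.
elim: s => [|u s [r rP]]; first by exists [::].
pose v := u - \sum_(p <- r) p.1 u *: p.2.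
have [v0|/exists_separating_form[phi phiL phiv]] := eqVneq v 0.
  exists r => w; rewrite inE => /predU1P[->|]; last exact: rP.
  by apply/eqP; rewrite -subr_eq0 -/v v0.
pose f w := phi (w - \sum_(p <- r) p.1 w *: p.2).
have fL : linear_for *%R f.
  move=> c w w'; rewrite -phiL /f; congr phi.
  rewrite scalerBr addrACA -opprD scaler_sumr -big_split /=.
  congr (_ - _); apply: eq_bigr => p _.
  by rewrite linearP scalerDl scalerA.
exists ((dual_of fL, v) :: r) => w; rewrite inE big_cons /= => /predU1P[->|ws].
  by rewrite /f -/v phiv scale1r subrK.
have phi0 : phi 0 = 0 by rewrite -[0](subrr u) -scaleN1r addrC phiL mulN1r addNr.
by rewrite /f -rP // subrr phi0 scale0r add0r.
Qed.
End DualConvolution.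

(** * Coinvariants of right multiplication by the unit *)

Section Coinvariants.
Variables (K : fieldType) (g : lmodType K) (br : g -> g -> g).
Notation H := (env br).
Notation H2 := (ktens H H).
Notation X := (dual br).
Variables (V : lmodType H).
Local Notation one2 := (kpure 1 1 : H2).

Lemma tens2_ind1 (Q : tens2 V -> Prop) :
  Q 0 -> (forall s t, Q s -> Q t -> Q (s + t)) ->
  (forall f v, Q (pure2 (kpure f 1) v)) -> forall t, Q t.
Proof.
move=> Q0 QD Q1 t; have [s ->] := tens2_normal t.
elim: s => [|p s IH]; first by rewrite big_nil.
by rewrite big_cons; apply: QD.
Qed.

Lemma tcontr12_lift_r x (t : tens2 V) :
  tcontr12 x (lift_r one2 t) = pure2 one2 (tcontr x t).
Proof.
elim/tens2_ind1: t => [|s t IHs IHt|f v].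
- by rewrite lift_r0 tcontr12_0 tcontr0 pure2_0r.
- by rewrite lift_rD tcontr12D IHs IHt tcontrD pure2Dr.
rewrite lift_rE one_tensE id_DeltaE Delta1 -tens_assocM kpureM !mul1r.
rewrite tens_assocE tcontr12E contr12_pure contr_pure1 kpureZl pure2Z.
by rewrite tcontrE contr_pure1.
Qed.

Lemma tcontr_tcontr23 x y (t : tens2 V) :
  tcontr y (tcontr23 x (lift_l one2 t)) = tcontr (dualM y x) t.
Proof.
elim/tens2_ind1: t => [|s t IHs IHt|f v].
- by rewrite lift_l0 tcontr23_0 !tcontr0.
- by rewrite lift_lD tcontr23D !tcontrD IHs IHt.
by rewrite tcontr23_lift_l mul1r !tcontrE contr_contr23_Delta.
Qed.

Lemma tcontr23_counit f (t : tens2 V) :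
  tcontr23 (dual1 br) (lift_l (kpure f 1) t) = lmul2 (kpure f 1) t.
Proof.
elim/tens2_ind1: t => [|s t IHs IHt|h v].
- by rewrite lift_l0 tcontr23_0 lmul2_0.
- by rewrite lift_lD tcontr23D IHs IHt lmul2D.
by rewrite tcontr23_lift_l lmul2E contr23_counit.
Qed.

Variables (pp : pseudoproduct V) (hpp : is_assoc_pseudoalgebra pp).
Variables (e : V) (ee : pp e e = pure2 one2 e).
Hypothesis e1 : forall r, tcontr (dual1 br) (pp e r) = r.
Let ppb := pp_bilinear hpp.

Definition coinvariant (a : V) : Prop := pp a e = pure2 one2 a.

(** With a * b in normal form, a * (b * e) = a * ((1 (x) 1) (x)_H b) is nontrivial in its first leg
    only. Pairing that leg with x leaves (1 (x) 1) (x)_H (a_x b), whatever a is. *)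
Lemma coinvariant_tcontr x a b : coinvariant b -> coinvariant (tcontr x (pp a b)).
Proof.
move=> bI.
by rewrite /coinvariant -(tcontr12_pp_l ppb) (ppA hpp) bI (pp_rE ppb) tcontr12_lift_r.
Qed.

(** Contract legs 2, 3 of (a * e) * b. The case y = 1 is a_1 (e_x b) = a_x b, and the case a = e is
    the module law for the action of X by e. *)
Lemma tcontr_pp_unit x y a b : coinvariant a ->
  tcontr y (pp a (tcontr x (pp e b))) = tcontr (dualM y x) (pp a b).
Proof.
move=> aI.
by rewrite -(tcontr23_pp_r ppb) -(ppA hpp) aI (pp_lE ppb) tcontr_tcontr23.
Qed.

(** The counit on the second leg undoes the coproducts in (a * b) * c. Both the associativity of a_1
    b and the rule for x(a b) start from this form of a * (b_1 c). *)
Lemma pp_tcontr_counit s a b c : pp a b = \sum_(p <- s) pure2 (kpure p.1 1) p.2 ->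
  pp a (tcontr (dual1 br) (pp b c)) = \sum_(p <- s) lmul2 (kpure p.1 1) (pp p.2 c).
Proof.
move=> abE; rewrite -(tcontr23_pp_r ppb) -(ppA hpp) abE.
elim: s {abE} => [|p s IH].
  by rewrite !big_nil (pp_l0 ppb) tcontr23_0.
rewrite !big_cons (pp_lD ppb) tcontr23D IH (pp_lE ppb).
by rewrite tcontr23_counit.
Qed.

Lemma tcontr_lmul2 x f (s : seq (H * V)) :
  tcontr x (lmul2 (kpure f 1) (\sum_(p <- s) pure2 (kpure p.1 1) p.2)) =
  \sum_(p <- s) (x (antipode p.1 * antipode f))%:A *: p.2.
Proof.
rewrite lmul2_sum tcontr_sum; apply: eq_bigr => p _.
by rewrite lmul2E kpureM mulr1 tcontrE contr_pure1 antipodeM.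
Qed.

Lemma tcontr_counitA a b c :
  tcontr (dual1 br) (pp a (tcontr (dual1 br) (pp b c))) =
  tcontr (dual1 br) (pp (tcontr (dual1 br) (pp a b)) c).
Proof.
have [s sE] := tens2_normal (pp a b).
rewrite (pp_tcontr_counit c sE) sE tcontr_normal tcontr_sum.
rewrite (pp_suml ppb) tcontr_sum; apply: eq_bigr => p _.
rewrite (tcontr_ppZl ppb); have [r ->] := tens2_normal (pp p.2 c).
rewrite tcontr_lmul2 tcontr_normal scaler_sumr; apply: eq_bigr => q _ /=.
by rewrite counitM mulrC scalerA -scalerAl mul1r scalerA.
Qed.

Hypothesis ss : is_semisimple pp.

Lemma pp_unit_inj r : pp r e = 0 -> r = 0.
Proof.
have ann a b : pp a e = 0 -> pp a b = 0.
  move=> ae; rewrite -(e1 b) -(tcontr23_pp_r ppb) -(ppA hpp) ae (pp_l0 ppb).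
  by rewrite tcontr23_0.
pose I : set V := [set a | pp a e = 0]%classic.
apply: (ss (I := I)); last first.
  by exists 1%N => c [a [x [b [aI _ ->]]]]; rewrite xprodE (ann _ _ aI) tcontr0.
split=> [|a b aI bI|h a aI|x a b aI|x a b bI]; rewrite /I /=.
- exact: pp_0l.
- by rewrite (ppDl ppb) aI bI addr0.
- by rewrite (pp_Zl ppb) aI lmul2_0.
- by rewrite xprodE (ann _ _ aI) tcontr0 (pp_0l ppb).
by rewrite xprodE -(tcontr12_pp_l ppb) (ppA hpp) bI (pp_r0 ppb) tcontr12_0.
Qed.

(* With r * e = \sum (f_i (x) 1) (x)_H a_i and all a_i coinvariant, r - \sum f_i a_i
   annihilates e. *)
Lemma coinvariant_generate r : exists2 s : seq (H * V),
  (forall p, p \in s -> coinvariant p.2) & r = \sum_(p <- s) p.1 *: p.2.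
Proof.
have [t tE] := tens2_normal (pp r e).
(* [q] plays the role of a basis for the first legs of r * e. The corresponding coefficients are
   a(x) = r_(S(x)) e, the twist by S undoing the antipode built into x-products. *)
have [q qP] := finite_rank_identity [seq p.1 | p <- t].
pose a (x : X) := \sum_(p <- t) (x p.1)%:A *: p.2.
have aI x : coinvariant (a x).
  suff -> : a x = tcontr (dualS x) (pp r e) by exact: coinvariant_tcontr.
  rewrite tE tcontr_normal; apply: eq_bigr => p _ /=.
  by rewrite antipodeK.
exists [seq (p.2, a p.1) | p <- q] => [_ /mapP[p _ ->]|]; first exact: aI.
rewrite big_map; apply/eqP; rewrite -subr_eq0; apply/eqP/pp_unit_inj.
have ppN v : pp (- v) e = - pp v e.
  apply: (addrI (pp v e)); rewrite -(ppDl ppb) !subrr; exact: pp_0l.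
rewrite (ppDl ppb) ppN; apply/eqP; rewrite subr_eq0; apply/eqP.
rewrite (pp_suml ppb) tE [LHS]big_seq.
transitivity (\sum_(p <- t) \sum_(i <- q) pure2 (kpure i.2 1) ((i.1 p.1)%:A *: p.2)).
  rewrite [RHS]big_seq; apply: eq_bigr => p pt.
  rewrite {1}(qP p.1); last exact: map_f.
  rewrite (big_morph (fun f => kpure f 1) (id1 := 0) (op1 := +%R)).
  - rewrite pure2_suml; apply: eq_bigr => i _.
    by rewrite kpureZl pure2Z.
  - by move=> u v; rewrite kpureDl.
  by rewrite -(scale0r (0 : H)) kpureZl scale0r.
rewrite exchange_big; apply: eq_bigr => i _ /=.
by rewrite (pp_Zl ppb) aI lmul2E mulr1 -pure2_sumr.
Qed.
End Coinvariants.

(** * The product rule in a dual basis *)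

Section DualBasis.
Variables (K : fieldType) (g : lmodType K) (br : g -> g -> g).
Notation H := (env br).
Notation X := (dual br).
Variables (I : choiceType) (h : I -> H) (xi : I -> X).
Hypothesis hxi : is_dual_basis h xi.

(** Finitely many elements involve finitely many basis vectors in total, and all other coordinates
    vanish on them; this is what truncates sums over I. *)
Lemma dual_basis_finite (s : seq H) : exists2 L : seq I, uniq L &
  forall u, u \in s -> u = \sum_(i <- L) xi i u *: h i /\
    forall i, i \notin L -> xi i u = 0.
Proof.
have [S SP] := choice (dual_basis_span hxi).
pose L := undup (flatten [seq S u | u <- s]).
exists L => [|u us]; first exact: undup_uniq.
have SL i : i \in S u -> i \in L.
  by move=> iS; rewrite mem_undup; apply/flatten_mapP; exists u.
have [c uE] := SP u.
have xiE i : xi i u = \sum_(j <- S u) c j * (i == j)%:R.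
  rewrite {1}uE linear_sum; apply: eq_bigr => j _.
  by rewrite linearZ /= (dual_basisE hxi).
split=> [|i iL]; last first.
  rewrite xiE big_seq big1 // => j /SL jL.
  case: eqP => [ij|_]; last by rewrite mulr0.
  by rewrite ij jL in iL.
under eq_bigr do rewrite xiE scaler_suml.
rewrite exchange_big {1}uE big_seq [RHS]big_seq; apply: eq_bigr => j /SL jL.
rewrite (bigD1_seq j) ?undup_uniq //= eqxx mulr1 big1 ?addr0 // => i ij.
by rewrite (negbTE ij) mulr0 scale0r.
Qed.

Variables (V : lmodType H) (pp : pseudoproduct V) (hpp : is_assoc_pseudoalgebra pp).
Variables (e : V).

(* The rule x(ab) = \sum x_(2)(a) x_(1)(b), read off from the second form of
   e * (a * b) = (e * a) * b. *)
Lemma tcontr_coproduct x a b :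
  exists2 L : seq I, uniq L &
  [/\ tcontr x (pp e (tcontr (dual1 br) (pp a b))) =
      \sum_(p <- L) \sum_(q <- L) (x (h p * h q))%:A *:
        tcontr (xi p) (pp (tcontr (xi q) (pp e a)) b),
      forall q, q \notin L -> tcontr (xi q) (pp e a) = 0 &
      forall p q, p \notin L -> tcontr (xi p) (pp (tcontr (xi q) (pp e a)) b) = 0].
Proof.
have ppb := pp_bilinear hpp.
have [s sE] := tens2_normal (pp e a).
have [G GE] := choice (fun v => tens2_normal (pp v b)).
(* The images under S of all first legs of e * a and of the products of its coefficients with b, so
   that a single L truncates both indices of the double sum. *)
pose us := [seq antipode k.1 | k <- s] ++
  flatten [seq [seq antipode l.1 | l <- G k.2] | k <- s].
have [L uL LP] := dual_basis_finite us.
have sL k : k \in s -> antipode k.1 \in us.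
  move=> ks; rewrite mem_cat; apply/orP; left.
  by apply/mapP; exists k.
have GL k l : k \in s -> l \in G k.2 -> antipode l.1 \in us.
  move=> ks lG; rewrite mem_cat; apply/orP; right.
  by apply/flatten_mapP; exists k => //; apply/mapP; exists l.
have qE q : tcontr (xi q) (pp e a) = \sum_(k <- s) (xi q (antipode k.1))%:A *: k.2.
  by rewrite sE tcontr_normal.
have pqE p q : tcontr (xi p) (pp (tcontr (xi q) (pp e a)) b) =
    \sum_(k <- s) \sum_(l <- G k.2)
      (xi q (antipode k.1) * xi p (antipode l.1))%:A *: l.2.
  rewrite qE (pp_suml ppb) tcontr_sum; apply: eq_bigr => k _.
  rewrite (tcontr_ppZl ppb) GE tcontr_normal scaler_sumr; apply: eq_bigr => l _.
  by rewrite scalerA -scalerAl mul1r scalerA.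
exists L => //; split=> [|q qL|p q pL]; last 2 first.
- rewrite qE big_seq big1 // => k ks.
  by rewrite (LP _ (sL _ ks)).2 // scale0r scale0r.
- rewrite pqE big_seq big1 // => k ks; rewrite big_seq big1 // => l lG.
  by rewrite (LP _ (GL _ _ ks lG)).2 // mulr0 scale0r scale0r.
rewrite (pp_tcontr_counit hpp b sE) tcontr_sum.
under [RHS]eq_bigr do under eq_bigr do rewrite pqE scaler_sumr.
under [RHS]eq_bigr do rewrite exchange_big.
rewrite exchange_big big_seq [RHS]big_seq; apply: eq_bigr => k ks.
rewrite GE tcontr_lmul2.
under [RHS]eq_bigr do under eq_bigr do rewrite scaler_sumr.
under [RHS]eq_bigr do rewrite exchange_big.
rewrite exchange_big big_seq [RHS]big_seq; apply: eq_bigr => l lG.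
under [RHS]eq_bigr do under eq_bigr do rewrite scalerA.
under [RHS]eq_bigr do rewrite -scaler_suml.
rewrite -scaler_suml; congr (_ *: _).
(* It remains to expand x(S(l.1) S(k.1)) in both factors. The antipode has reversed the product, so
   the factor coming from e * a stands second: this is the origin of the opposite coproduct. *)
rewrite {1}(LP _ (GL _ _ ks lG)).1 {1}(LP _ (sL _ ks)).1.
rewrite mulr_suml linear_sum scaler_suml; apply: eq_bigr => p _.
rewrite mulr_sumr linear_sum scaler_suml; apply: eq_bigr => q _.
rewrite -scalerAl -scalerAr scalerA linearZ -scalerAl mul1r scalerA /=.
by congr (_ *: _); rewrite mulrC; congr (_ * _); rewrite mulrC.
Qed.
End DualBasis.

(** * The coinvariants as a vector space over K *)

Section RestrictScalars.
Variables (K : fieldType) (g : lmodType K) (br : g -> g -> g).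
Notation H := (env br).
Variables (V : lmodType H).

(** A separate name for V, which keeps its K-scalars, acting through the multiples of 1 in H, apart
    from its H-scalars. *)
Definition restr : Type := V.
HB.instance Definition _ := GRing.Zmodule.on restr.
Definition restr_scale (c : K) (v : restr) : restr := (c%:A : H) *: (v : V).
Fact restr_scaleA a b v : restr_scale a (restr_scale b v) = restr_scale (a * b) v.
Proof. by rewrite /restr_scale scalerA -scalerAl mul1r scalerA. Qed.
Fact restr_scale1 : left_id 1 restr_scale.
Proof. by move=> v; rewrite /restr_scale !scale1r. Qed.
Fact restr_scaleDr : right_distributive restr_scale +%R.
Proof. by move=> c v w; apply: scalerDr. Qed.
Fact restr_scaleDl v : {morph restr_scale^~ v : a b / a + b}.
Proof. by move=> a b; rewrite /restr_scale !scalerDl. Qed.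
HB.instance Definition _ := GRing.Zmodule_isLmodule.Build K restr
  restr_scaleA restr_scale1 restr_scaleDr restr_scaleDl.
End RestrictScalars.

Section CoinvariantSubspace.
Variables (K : fieldType) (g : lmodType K) (br : g -> g -> g).
Notation H := (env br).
Notation H2 := (ktens H H).
Notation X := (dual br).
Variables (V : lmodType H) (pp : pseudoproduct V) (e : V).

(* The unused argument records what makes the predicate closed, so that the
   subspace instance can be attached to it. *)
Definition coinv_pred of is_bilinear_pp pp : {pred restr V} :=
  fun a => `[< coinvariant pp e a >].

Variable ppb : is_bilinear_pp pp.
Fact coinv_pred_closed : submod_closed (coinv_pred ppb).
Proof.
split=> [|c a b]; rewrite !unfold_in /=.
  apply/asboolP; rewrite /coinvariant (pp_0l ppb).
  by rewrite pure2_0r.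
move=> /asboolP aI /asboolP bI; apply/asboolP.
rewrite /coinvariant (ppDl ppb) (pp_Zl ppb) aI bI pure2Dr lmul2E mulr1.
by rewrite -[_ *: 1]/(c *: 1) kpureZl pure2Z.
Qed.
HB.instance Definition _ := GRing.isSubmodClosed.Build K (restr V)
  (coinv_pred ppb) coinv_pred_closed.

Record coinv := Coinv { coinv_val : restr V; _ : coinv_val \in coinv_pred ppb }.
HB.instance Definition _ := [isSub for coinv_val].
HB.instance Definition _ := [Choice of coinv by <:].
HB.instance Definition _ := [SubChoice_isSubLmodule of coinv by <:].

Lemma coinv_valP (a : coinv) : coinvariant pp e (coinv_val a).
Proof. by case: a => a aP /=; move/asboolP: aP. Qed.
End CoinvariantSubspace.

(** * The algebra A and the isomorphism of Diff A with R *)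

Section Differential.
Variables (K : fieldType) (g : lmodType K) (br : g -> g -> g).
Notation H := (env br).
Notation H2 := (ktens H H).
Notation X := (dual br).
Variables (V : lmodType H) (pp : pseudoproduct V) (hpp : is_assoc_pseudoalgebra pp).
Variables (e : V) (ee : pp e e = pure2 (kpure 1 1 : H2) e).
Hypothesis e1 : forall r, tcontr (dual1 br) (pp e r) = r.
Hypothesis ss : is_semisimple pp.
Let ppb := pp_bilinear hpp.

Let A : lmodType K := coinv e ppb.
Let val_A (a : A) : V := coinv_val a.

Lemma val_A_inj : injective val_A.
Proof. exact: val_inj. Qed.
Lemma val_AP a : coinvariant pp e (val_A a).
Proof. exact: coinv_valP. Qed.
Lemma val_AD : {morph val_A : a b / a + b}.
Proof. by []. Qed.
Lemma val_AZ c a : val_A (c *: a) = c%:A *: val_A a.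
Proof. by []. Qed.
Lemma val_A0 : val_A 0 = 0.
Proof. by []. Qed.
Lemma val_A_sum (I : Type) (r : seq I) (F : I -> A) :
  val_A (\sum_(i <- r) F i) = \sum_(i <- r) val_A (F i).
Proof. exact: (big_morph _ val_AD val_A0). Qed.

Lemma coinv_mem v : coinvariant pp e v -> (v : restr V) \in coinv_pred e ppb.
Proof. by move=> vI; apply/asboolP. Qed.

(** Both operations on A are instances: x = 1 with v in A for the product, v = e for the action.
    Coinvariance of the right factor suffices for the result to lie in A. *)
Definition coinv_prod (x : X) (v : V) (b : A) : A :=
  Coinv (coinv_mem (coinvariant_tcontr hpp x v (val_AP b))).
Lemma coinv_prodE x v b : val_A (coinv_prod x v b) = tcontr x (pp v (val_A b)).
Proof. by []. Qed.

Definition coinv_mul (a b : A) : A := coinv_prod (dual1 br) (val_A a) b.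
Definition coinv_act (x : X) (a : A) : A := coinv_prod x e a.

Lemma coinv_xcop : is_Xcop_algebra coinv_mul coinv_act.
Proof.
have Dr x v a b c : tcontr x (pp v (val_A (c *: a + b))) =
    c%:A *: tcontr x (pp v (val_A a)) + tcontr x (pp v (val_A b)).
  by rewrite val_AD val_AZ (ppDr ppb) tcontrD (tcontr_ppZr ppb).
split.
- move=> b c a a'; apply: val_A_inj; rewrite val_AD val_AZ !coinv_prodE.
  by rewrite val_AD val_AZ (ppDl ppb) tcontrD (tcontr_ppZl ppb).
- move=> a c b b'; apply: val_A_inj; rewrite val_AD val_AZ !coinv_prodE.
  exact: Dr.
- move=> a b c; apply: val_A_inj; rewrite !coinv_prodE; exact: tcontr_counitA.
- move=> a c x y; apply: val_A_inj; rewrite val_AD val_AZ !coinv_prodE.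
  exact: tcontr_comb.
- move=> x c a b; apply: val_A_inj; rewrite val_AD val_AZ !coinv_prodE.
  exact: Dr.
- by move=> a; apply: val_A_inj; rewrite coinv_prodE e1.
- move=> x y a; apply: val_A_inj; rewrite !coinv_prodE.
  by rewrite (tcontr_pp_unit hpp _ _ _ ee).
(* By a_1 (e_x b) = a_x b the summands are those of [tcontr_coproduct], whose list L bounds the
   support of the sum over I x I. *)
- move=> I h xi hxi x a b.
  pose F p := x (h p.1 * h p.2) *:
    coinv_mul (coinv_act (xi p.2) a) (coinv_act (xi p.1) b).
  have [L uL [xE q0 pq0]] :=
    tcontr_coproduct hxi hpp e x (val_A a) (val_A b).
  have FE p : val_A (F p) = (x (h p.1 * h p.2))%:A *:
      tcontr (xi p.1) (pp (tcontr (xi p.2) (pp e (val_A a))) (val_A b)).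
    rewrite val_AZ coinv_prodE [val_A (coinv_act (xi p.1) _)]coinv_prodE.
    by rewrite (tcontr_pp_unit hpp _ _ _ (val_AP _)) dual1M coinv_prodE.
  rewrite (fsbigE [seq (p, q) | p <- L, q <- L]); first last.
  - case=> p q _; rewrite -/(F (p, q)) => pqL; apply: val_A_inj; rewrite FE /=.
    have [qL|qL] := boolP (q \in L); last first.
      by rewrite q0 // (pp_0l ppb) tcontr0 scaler0.
    rewrite pq0 ?scaler0 //; apply: contra pqL => pL.
    by apply/allpairsP; exists (p, q).
  - by [].
  - by apply: allpairs_uniq => // -[p q] [p' q'].
  rewrite -[RHS]/(\sum_(i <- _ | _) F i).
  rewrite (eq_bigl xpredT); last by move=> p; rewrite in_setT.
  apply: val_A_inj; rewrite !coinv_prodE xE val_A_sum big_allpairs_dep.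
  by apply: eq_bigr => p _; apply: eq_bigr => q _; rewrite FE.
(* The value e_x a depends on x only through its values at S(f), for the finitely many first legs f
   of e * a. The forms of a finite-rank identity for these elements represent every x there, with
   coefficients x(h_i). *)
move=> a; have [s sE] := tens2_normal (pp e (val_A a)).
have [r rP] := finite_rank_identity [seq antipode p.1 | p <- s].
exists (size r), (fun i => (tnth (in_tuple r) i).1) => x.
exists (fun i => x (tnth (in_tuple r) i).2).
apply: val_A_inj; rewrite val_A0 coinv_prodE sE tcontr_normal.
rewrite big_seq big1 // => p ps.
suff -> : (x - \sum_(i < size r) x (tnth (in_tuple r) i).2 *: (tnth (in_tuple r) i).1)
    (antipode p.1) = 0 by rewrite scale0r scale0r.
have sumE (J : finType) (F : J -> X) u : (\sum_i F i : X) u = \sum_i F i u.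
  by apply: (big_morph (fun y : X => y u)).
rewrite -[LHS]/(x _ - (\sum_(i < size r) _ : X) _) sumE.
rewrite {1}(rP (antipode p.1)); last by apply/mapP; exists p.
rewrite linear_sum big_tnth -sumrB big1 // => i _.
by rewrite linearZ /= -[X in _ - X]/(x _ * _) mulrC subrr.
Qed.

Definition diff_eval : diff br A -> V :=
  klift (fun (h : H) (a : A) => h *: val_A a : restr V).

Lemma diff_eval_lin (a : A) : linear (fun h : H => h *: val_A a : restr V).
Proof.
move=> c h h'; rewrite -[RHS]/(c%:A *: (h *: val_A a) + h' *: val_A a).
by rewrite scalerDl scalerA -scalerAl mul1r.
Qed.
Lemma diff_eval_lin' (h : H) : linear (fun a : A => h *: val_A a : restr V).
Proof.
move=> c a a'; rewrite -[RHS]/(c%:A *: (h *: val_A a) + h *: val_A a').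
by rewrite val_AD val_AZ scalerDr !scalerA -scalerAl -scalerAr mul1r mulr1.
Qed.

Lemma diff_evalE h a : diff_eval (diff_pure h a) = h *: val_A a.
Proof. exact: klift_pure diff_eval_lin diff_eval_lin'. Qed.
Lemma diff_evalD s t :
  diff_eval (s + t) = diff_eval s + diff_eval t.
Proof. exact: (kliftD diff_eval_lin diff_eval_lin' s t). Qed.
Lemma diff_eval0 : diff_eval 0 = 0.
Proof. exact: klift0 diff_eval_lin diff_eval_lin'. Qed.
Lemma diff_eval_sum (I : Type) (r : seq I) (F : I -> diff br A) :
  diff_eval (\sum_(i <- r) F i) = \sum_(i <- r) diff_eval (F i).
Proof. exact: (big_morph _ diff_evalD diff_eval0). Qed.
Lemma diff_evalZ h t : diff_eval (h *: t) = h *: diff_eval t.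
Proof.
elim/ktens_ind: t => [s t IHs IHt|k a].
  by rewrite scalerDr !diff_evalD scalerDr IHs IHt.
rewrite -[h *: _]/(diff_scale h (diff_pure k a)) diff_scale_pure.
by rewrite !diff_evalE scalerA.
Qed.

(** If \sum h_p a_p = 0, its product with e gives \sum (h_p (x) 1) (x)_H a_p = 0, and contracting
    with S(x) gives \sum x(h_p) a_p = 0 for every x. A finite-rank identity for the h_p writes the
    original tensor through such sums. *)
Lemma diff_eval_eq0 t : diff_eval t = 0 -> t = 0.
Proof.
have [s ->] := ktens_normal t.
rewrite [X in X = 0]diff_eval_sum => s0.
have [r rP] := finite_rank_identity [seq p.1 | p <- s].
have coef (x : X) : \sum_(p <- s) x p.1 *: p.2 = 0 :> A.
  apply: val_A_inj; rewrite val_A_sum val_A0.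
  transitivity (tcontr (dualS x)
      (pp (\sum_(p <- s) diff_eval (kpure p.1 p.2)) e)); last first.
    by rewrite s0 (pp_0l ppb) tcontr0.
  rewrite (pp_suml ppb) tcontr_sum; apply: eq_bigr => p _.
  rewrite [diff_eval _]diff_evalE (pp_Zl ppb) (val_AP p.2) lmul2E mulr1.
  by rewrite tcontrE contr_pure1 /= antipodeK.
transitivity (\sum_(p <- s) \sum_(i <- r) kpure i.2 (i.1 p.1 *: p.2) : ktens H A).
  rewrite [LHS]big_seq [RHS]big_seq; apply: eq_bigr => p ps.
  rewrite {1}(rP p.1); last exact: map_f.
  by rewrite kpure_suml; apply: eq_bigr => i _; rewrite kpureZl kpureZr.
rewrite exchange_big big1 // => i _.
by rewrite -kpure_sumr coef -(scale0r (0 : A)) kpureZr scale0r.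
Qed.

Lemma diff_eval_inj : injective diff_eval.
Proof.
move=> s t st; apply/eqP; rewrite -subr_eq0; apply/eqP/diff_eval_eq0.
by rewrite diff_evalD -scaleN1r diff_evalZ st scaleN1r subrr.
Qed.

Lemma diff_eval_surj v : exists t, diff_eval t = v.
Proof.
have [s sI ->] := coinvariant_generate hpp ee e1 ss v.
elim: s sI => [|p s IH] sI; first by exists 0; rewrite big_nil diff_eval0.
have [|t tE] := IH; first by move=> q qs; apply: sI; rewrite inE qs orbT.
have pI : coinvariant pp e p.2 by apply: sI; rewrite mem_head.
exists (diff_pure p.1 (Coinv (coinv_mem pI)) + t).
by rewrite diff_evalD tE big_cons diff_evalE.
Qed.

Lemma unit_differential : is_differential pp.
Proof.
exists A, coinv_mul, coinv_act; split; first exact: coinv_xcop.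
have [phi phiK] := choice diff_eval_surj.
have evalK : cancel diff_eval phi by move=> t; apply: diff_eval_inj.
have phiL : linear phi.
  move=> h v w; apply: diff_eval_inj.
  by rewrite diff_evalD diff_evalZ !phiK.
(* The pseudoproduct of R transported along the bijection: [phi] is then an isomorphism by
   construction, and [diff_ppE] reduces to a_x b = a_1 (e_x b). *)
pose dpp (s t : diff br A) := map2 phi (pp (diff_eval s) (diff_eval t)).
exists dpp; last first.
  exists phi; last by exists diff_eval.
  by split=> // a b; rewrite /dpp !phiK.
split=> [|x a b].
  split=> [s t u|s t u|f h s t]; rewrite /dpp.
  - by rewrite diff_evalD (ppDl ppb) (map2D phiL).
  - by rewrite diff_evalD (ppDr ppb) (map2D phiL).
  by rewrite !diff_evalZ (ppH ppb) (map2_lmul2 phiL).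
rewrite xprodE /dpp (tcontr_map2 phiL); apply: diff_eval_inj.
rewrite phiK !diff_evalE !scale1r !coinv_prodE.
by rewrite (tcontr_pp_unit hpp _ _ _ (val_AP a)) dual1M.
Qed.
End Differential.

(** * The unit as the image of the generator of Cur *)

Section Unital.
Variables (K : fieldType) (g : lmodType K) (br : g -> g -> g).
Variables (V : lmodType (env br)) (pp : pseudoproduct V).

Lemma semisimple_unital_differential : is_assoc_pseudoalgebra pp ->
  is_semisimple pp -> is_unital pp -> is_differential pp.
Proof.
move=> hpp ss [phi [[phiL phiM] _ e1]].
apply: (unit_differential hpp (e := phi 1)) => //.
  by rewrite phiM /cur_pp (map2E phiL).
by move=> r; rewrite -xprodE.
Qed.
End Unital.

Local Open Scope complex_scope.

Theorem theorem0p1 (R : realType) (g : vectType R[i]) (br : g -> g -> g)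
  (hbr : is_lie_bracket br) (V : lmodType (env br)) (pp : pseudoproduct V)
  (hpp : is_assoc_pseudoalgebra pp) (hss : is_semisimple pp)
  (hun : is_unital pp) :
  is_differential pp.
Proof. exact: semisimple_unital_differential. Qed.
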